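(* Let $u:\Gamma_0\to\mathbb{R}$ be a measurable function with $u(\emptyset)=0$, and suppose that there exist $C,C'>0$ and $\delta,\delta'\in[0,1)$ such that $u\in\mathcal{K}_{C,\delta}$ and $\exp^\ast|u|\in\mathcal{K}_{C',\delta'}$. Then, for $k=\exp^\ast u$, one has $B_k(f)>0$ for all $f\in L^1(X,dm)$, where $$B_k(f)=\int_{\Gamma_0}e_\lambda(f,\eta)\,k(\eta)\,d\lambda(\eta).$$
   Context: Let $X$ be a connected oriented non-compact Riemannian $C^\infty$-manifold with Borel $\sigma$-algebra $\mathcal{B}(X)$, and let $\mathcal{B}_{\mathrm c}(X)$ be the class of Borel sets with compact closure. Let $m$ be a non-atomic Radon measure on $X$: $m(\Lambda)<\infty$ for $\Lambda\in\mathcal{B}_{\mathrm c}(X)$ and $m(\{x\})=0$ for $x\in X$. Assume there is an increasing sequence $\Lambda_n\in\mathcal{B}_{\mathrm c}(X)$ with $\bigcup_n\Lambda_n=X$. For $n\in\mathbb{N}$ let $\Gamma^{(n)}=\{\eta\subset X: |\eta|=n\}$, where $|\eta|$ is the number of points of $\eta$; $\Gamma^{(0)}=\{\emptyset\}$. $\Gamma^{(n)}$ is identified with the quotient of $\widetilde{X^n}=\{(x_1,\dots,x_n)\in X^n: x_k\neq x_l \text{ if } k\ne l\}$ by the permutation group $S_n$ and carries the quotient topology. The space of finite configurations is the disjoint union $\Gamma_0=\bigsqcup_{n\ge 0}\Gamma^{(n)}$ with the disjoint-union topology and its Borel $\sigma$-algebra. Let $m^{(n)}$ be the image on $\Gamma^{(n)}$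 of $m^{\otimes n}$ (restricted to $\widetilde{X^n}$) under $(x_1,\dots,x_n)\mapsto\{x_1,\dots,x_n\}$, and $m^{(0)}(\{\emptyset\})=1$. The Lebesgue--Poisson measure is $\lambda=\sum_{n=0}^\infty\frac1{n!}m^{(n)}$ on $\Gamma_0$. For measurable $G_1,G_2:\Gamma_0\to\mathbb{R}$, the $\ast$-convolution is $(G_1\ast G_2)(\eta)=\sum_{\xi\subset\eta}G_1(\xi)G_2(\eta\setminus\xi)$. $u^{\ast n}$ is the $n$-fold $\ast$-convolution of $u$ with itself, $u^{\ast 0}(\eta)=1^\ast(\eta)=0^{|\eta|}$ (equal to $1$ at $\emptyset$, $0$ otherwise). For measurable $u$ with $u(\emptyset)=0$, $\exp^\ast u(\eta)=\sum_{n=0}^\infty\frac1{n!}u^{\ast n}(\eta)$, a finite sum for each $\eta$ since $u^{\ast n}(\eta)=0$ for $n>|\eta|$. For $C>0$, $\delta\ge0$, $\mathcal{K}_{C,\delta}$ is the space of measurable functions $k:\Gamma_0\to\mathbb{R}$ with $|k(\eta)|\le \mathrm{const}\cdot C^{|\eta|}(|\eta|!)^\delta$ for $\lambda$-a.a. $\eta$. The Lebesgue--Poisson exponent of a measurable $f:X\to\mathbb{R}$ is $e_\lambda(f,\eta)=\prod_{x\in\eta}f(x)$ for $\eta\neq\emptyset$ and $e_\lambda(f,\emptyset)=1$. For $k\in\mathcal{K}_{C,\delta}$ with $\delta\in[0,1)$ the integral defining $B_k(f)$ converges absolutely for all $f\in L^1(X,dm)$. *)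

(* Defs.v *)
From HB Require Import structures.
From mathcomp Require Import all_boot all_order all_algebra finmap.
From mathcomp Require Import all_classical all_reals all_analysis.

Set Implicit Arguments.
Unset Strict Implicit.
Unset Printing Implicit Defensive.

Import Order.TTheory GRing.Theory Num.Theory.
Import numFieldNormedType.Exports.

Local Open Scope classical_set_scope.
Local Open Scope ring_scope.

(** * Oriented Riemannian manifolds *)

Section smoothness.
Context {R : realType} {d : nat} {V : normedModType R}.

(* [f] is meaningful on the open set [U] only; its values elsewhere do not
   matter, since all the conditions are local around the points of [U]. *)
Fixpoint Ck_on (U : set 'rV[R]_d) (k : nat) (f : 'rV[R]_d -> V) : Prop :=
  (forall p, U p -> {for p, continuous f}) /\
  if k is l.+1 then
    forall v : 'rV[R]_d,
      (forall p, U p -> derivable f p v) /\ Ck_on U l ('D_v f)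
  else True.

Definition smooth_on (U : set 'rV[R]_d) (f : 'rV[R]_d -> V) : Prop :=
  forall k, Ck_on U k f.

End smoothness.

(* A [d]-dimensional C^oo-manifold [X] given by an oriented atlas, with a
   Riemannian metric given by its matrices [riemann_metric i] in the charts.
   Tangent vectors are row vectors, so the differential of a map at [p] is
   [fun v => v *m 'J f p]. *)
Record oriented_riemannian_manifold (R : realType) (d : nat)
    (X : ptopologicalType) := OrientedRiemannianManifold {
  manifold_hausdorff : hausdorff_space X ;
  manifold_second_countable : @second_countable X ;
  chart_index : Type ;
  chart_dom : chart_index -> set X ;
  chart : chart_index -> X -> 'rV[R]_d ;
  chart_inv : chart_index -> 'rV[R]_d -> X ;
  transition (i j : chart_index) : 'rV[R]_d -> 'rV[R]_d :=
    chart j \o chart_inv i ;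
  overlap (i j : chart_index) : set 'rV[R]_d :=
    chart i @` (chart_dom i `&` chart_dom j) ;
  chart_cover : \bigcup_i chart_dom i = [set: X] ;
  chart_dom_open : forall i, open (chart_dom i) ;
  chart_image_open : forall i, open (chart i @` chart_dom i) ;
  chart_continuous : forall i x, chart_dom i x ->
    {for x, continuous (chart i)} ;
  chart_inv_continuous : forall i p, (chart i @` chart_dom i) p ->
    {for p, continuous (chart_inv i)} ;
  chartK : forall i x, chart_dom i x -> chart_inv i (chart i x) = x ;
  transition_smooth : forall i j, smooth_on (overlap i j) (transition i j) ;
  transition_oriented : forall i j p, overlap i j p ->
    0 < \det ('J (transition i j) p) ;
  riemann_metric : chart_index -> 'rV[R]_d -> 'M[R]_d ;
  riemann_metric_smooth : forall i,
    smooth_on (chart i @` chart_dom i) (riemann_metric i) ;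
  riemann_metric_sym : forall i p, (chart i @` chart_dom i) p ->
    (riemann_metric i p)^T = riemann_metric i p ;
  riemann_metric_posdef : forall i p (v : 'rV[R]_d),
    (chart i @` chart_dom i) p -> v != 0 -> 0 < (v *m riemann_metric i p *m v^T) 0 0 ;
  riemann_metric_compat : forall i j p, overlap i j p ->
    riemann_metric i p =
      'J (transition i j) p *m riemann_metric j (transition i j p) *m
      ('J (transition i j) p)^T
}.

(** * Borel sets and Radon measures *)

Notation borel T := (g_sigma_algebraType (@open T)).

Section radon.
Context {R : realType} {X : ptopologicalType}.

Definition Borel_compact_closure (L : set X) : Prop :=
  measurable (L : set (borel X)) /\ compact (closure L).

Definition nonatomic_radon (m : {measure set (borel X) -> \bar R}) : Prop :=
  (forall L, Borel_compact_closure L -> (m L < +oo)%E) /\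
  (forall x : X, m [set x] = 0%E).

End radon.

Definition has_exhaustion (X : ptopologicalType) : Prop :=
  exists L : nat -> set X,
    [/\ forall n, Borel_compact_closure (L n),
        forall n, L n `<=` L n.+1 &
        \bigcup_n L n = [set: X]].

(** * Finite configurations *)

(* The space Gamma_0; Gamma^(n) is its subset of the [eta] with
   [#|` eta| = n]. *)
Definition configuration (X : ptopologicalType) : Type := {fset X}.

HB.instance Definition _ (X : ptopologicalType) :=
  Choice.on (configuration X).
HB.instance Definition _ (X : ptopologicalType) :=
  isPointed.Build (configuration X) (fset0 : {fset X}).

Section configuration_topology.
Context {X : ptopologicalType}.

Definition row_tuple n (x : 'rV[X]_n) : n.-tuple X := [tuple x 0 i | i < n].

Definition conf_of n (t : n.-tuple X) : configuration X :=
  [fset x in (t : seq X)]%fset.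

(* [A] is open iff its trace on each Gamma^(n) is open for the quotient
   topology of the set of [n]-tuples of distinct points, itself a subspace of
   X^n, which is represented by ['rV[X]_n] with the product topology. *)
Definition conf_open (A : set (configuration X)) : Prop :=
  forall n, open ([set x | A (conf_of (row_tuple x))] :
    set (subspace [set x : 'rV[X]_n | uniq (row_tuple x)])).

Lemma conf_openT : conf_open setT.
Proof. by move=> n; exact: openT. Qed.

Lemma conf_openI : setI_closed conf_open.
Proof. by move=> A B oA oB n; exact: openI (oA n) (oB n). Qed.

Lemma conf_open_bigU (I : Type) (F : I -> set (configuration X)) :
  (forall i, conf_open (F i)) -> conf_open (\bigcup_i F i).
Proof.
by move=> oF n; apply: (@bigcup_open _ I setT) => i _; exact: oF.
Qed.

HB.instance Definition _ := isOpenTopological.Build (configuration X)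
  conf_openT conf_openI conf_open_bigU.

Lemma conf_openE : (@open (configuration X)) = conf_open.
Proof. by []. Qed.

End configuration_topology.

(** * Lebesgue-Poisson measure *)

Section lebesgue_poisson.
Context {R : realType} {X : ptopologicalType}.
Variable m : {measure set (borel X) -> \bar R}.
Local Open Scope ereal_scope.

Fixpoint tensor_power n : set (n.-tuple (borel X)) -> \bar R :=
  if n is l.+1 then
    pushforward (m \x (@tensor_power l))
      (fun p => [the l.+1.-tuple (borel X) of p.1 :: p.2])
  else \d_([tuple] : 0.-tuple (borel X)).

(* The image of the restriction of the [n]-th tensor power of [m] to the
   tuples of distinct points. *)
Definition conf_measure n : set (borel (configuration X)) -> \bar R :=
  pushforward (fun A : set (n.-tuple (borel X)) =>
      tensor_power (A `&` [set t | uniq (t : seq X)]))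
    (fun t => conf_of (t : n.-tuple X) : borel (configuration X)).

Definition lebesgue_poisson (A : set (borel (configuration X))) : \bar R :=
  \sum_(0 <= n <oo) ((n`!%:R)^-1)%:E * conf_measure n A.

End lebesgue_poisson.

(** * The convolution and its exponential *)

Section convolution.
Context {R : realType} {X : ptopologicalType}.
Implicit Types (u G : configuration X -> R) (eta : configuration X).

Definition star_conv G1 G2 eta : R :=
  \sum_(xi <- fpowerset (eta : {fset X})) G1 xi * G2 (eta `\` xi)%fset.

Definition star_one eta : R := 0 ^+ #|` eta|.

Definition star_pow u n : configuration X -> R := iter n (star_conv u) star_one.

Definition star_exp u eta : R :=
  limn (series (fun n => (n`!%:R)^-1 * star_pow u n eta)).

Definition lp_exponent (f : X -> R) eta : R :=
  \prod_(x <- (eta : {fset X})) f x.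

Variable m : {measure set (borel X) -> \bar R}.

Definition K_space (C delta : R) (k : configuration X -> R) : Prop :=
  measurable_fun [set: borel (configuration X)] k /\
  exists c : R, {ae lebesgue_poisson m, forall eta,
    `|k eta| <= c * C ^+ #|` eta| * ((#|` eta|)`!%:R `^ delta)}.

(* [fine] sends infinite values to 0, so [0 < bogoliubov m k f] entails that
   the integral is finite. *)
Definition bogoliubov (k : configuration X -> R) (f : X -> R) : R :=
  fine (\int[lebesgue_poisson m]_eta (lp_exponent f eta * k eta)%:E)%E.

End convolution.

(* Main.v *)
From HB Require Import structures.
Require Import Defs.
From mathcomp Require Import all_boot all_order all_algebra finmap.
From mathcomp Require Import all_classical all_reals all_analysis.
From mathcomp Require Import measurable_realfun ring.

Set Implicit Arguments.
Unset Strict Implicit.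
Unset Printing Implicit Defensive.

Import Order.TTheory GRing.Theory Num.Theory.
Import numFieldNormedType.Exports.

Local Open Scope classical_set_scope.
Local Open Scope ring_scope.

(** The functional is positive because it is an exponential:
    [B_k(f) = exp (\int e_lambda(f, eta) u(eta) dlambda(eta))] for [k = exp* u].

    Put [v = e_lambda(f) u]. Since [e_lambda(f, xi) e_lambda(f, eta \ xi) =
    e_lambda(f, eta)] for [xi] contained in [eta], multiplication by
    [e_lambda(f)] commutes with the convolution ([star_pow_lp_exponent]), so
    that [e_lambda(f) exp* u = exp* v] and [B_k(f)] is the integral of
    [exp* v]. The bound on [u] and [delta < 1] make [v] integrable
    ([integrable_lp_exponent]). Integration with respect to [lambda] is
    multiplicative for the convolution ([ge0_integral_star_conv] for
    nonnegative functions, [Rintegral_star_conv] for integrable ones), hence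
    [v^{*n}] has integral [a ^ n], with [a] the integral of [v]; by dominated
    convergence, with dominating function [exp* |v|], whose integral is the
    exponential of the integral of [|v|], the integral of [exp* v] is [exp a]
    ([integral_star_exp]).

    Multiplicativity is proved on lists of points. There the convolution obeys
    the Leibniz rule [D_x (F * G) = D_x F * G + F * D_x G], where
    [D_x F s = F (x :: s)], and if [J_n F] denotes the integral of [F] over
    lists of [n] points divided by [n!], then Fubini gives
    [(n + 1) J_{n+1} F = \int J_n (D_x F) dm(x)]. Induction on [n] yields
    [J_n (F * G) = sum_k J_k F J_{n-k} G] ([lp_term_conv]), and summing over
    [n] is a Cauchy product of nonnegative series ([lp_series_conv]). Lists
    with repeated points do not matter because [m] is nonatomic
    ([tensor_int_uniq]).

    The passage from lists to configurations rests on the fact that a function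
    of configurations is Borel as soon as it is a Borel function of the tuples
    of distinct points ([measurable_fun_configuration]): [X] being Hausdorff
    and second countable, the configurations are covered by countably many
    open sets over which the map from tuples to configurations has a
    measurable section. *)

(** * Borel sets of configurations *)

Section borel_configuration.
Context {X : ptopologicalType}.
Hypothesis X_hausdorff : hausdorff_space X.
Hypothesis X_countable : @second_countable X.

Lemma countable_base : exists V : nat -> set X, (forall i, open (V i)) /\
  forall x A, nbhs x A -> exists2 i, V i x & V i `<=` A.
Proof.
have [B /countable_injP[f finj] [Bopen Bnbhs]] := X_countable.
exists (fun i => \bigcup_(U in [set U | B U /\ f U = i]) U); split.
  by move=> i; apply: bigcup_open => U [/Bopen].
move=> x A /Bnbhs[U [BU Ux] UA]; exists (f U); first by exists U.
move=> y [W [BW fWU] Wy]; apply: UA.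
by rewrite -(finj W U) ?inE.
Qed.

(** The tuples of distinct points. *)
Definition uniq_tuples n : set (n.-tuple (borel X)) := [set t | uniq t].

(** The complement of the diagonal is measurable for the product
    sigma-algebra because [X] is Hausdorff and second countable. *)
Lemma measurable_neq n (i j : 'I_n) :
  measurable [set t : n.-tuple (borel X) | tnth t i != tnth t j].
Proof.
have [V [Vopen Vbase]] := countable_base.
rewrite [X in measurable X](_ : _ =
  \bigcup_(a in [set a : nat * nat | V a.1 `&` V a.2 = set0])
    ((fun t => tnth t i) @^-1` V a.1 `&` (fun t => tnth t j) @^-1` V a.2)).
  have mV k l : measurable ((fun t : n.-tuple (borel X) => tnth t k) @^-1` V l).
    rewrite -[X in measurable X]setTI; apply: measurable_tnth => //.
    by apply: sub_sigma_algebra; exact: Vopen.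
  rewrite bigcup_mkcond; apply: countable_bigcupT_measurable => // a.
  by case: ifP => // _; exact: measurableI.
apply/seteqP; split => [t /= tij|t [a /= Va0] [Vi Vj]].
  move: X_hausdorff; rewrite open_hausdorff => /(_ _ _ tij)[[A B]] /=.
  move=> [/set_mem Ai /set_mem Bj] [oA oB /eqP AB0].
  have [a Vai VaA] : exists2 a, V a (tnth t i) & V a `<=` A.
    by apply: Vbase; exact: open_nbhs_nbhs.
  have [b Vbj VbB] : exists2 b, V b (tnth t j) & V b `<=` B.
    by apply: Vbase; exact: open_nbhs_nbhs.
  exists (a, b) => //=; apply/seteqP; split => // x [/VaA ? /VbB ?].
  by rewrite -AB0.
apply/eqP => ij; suff : (V a.1 `&` V a.2) (tnth t i) by rewrite Va0.
by split => //; rewrite ij.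
Qed.

Lemma measurable_uniq_tuples n : measurable (@uniq_tuples n).
Proof.
rewrite [X in measurable X](_ : _ = \bigcap_(i in [set: 'I_n])
  \bigcap_(j in [set j | i != j])
    [set t : n.-tuple (borel X) | tnth t i != tnth t j]).
  apply: fin_bigcap_measurable => [|i _]; first exact: finite_finset.
  by apply: fin_bigcap_measurable => [|j _]; [exact: finite_finset|exact: measurable_neq].
apply/seteqP; split => [t /tuple_uniqP tinj i _ j /= ij|t tn].
  by apply: contra ij => /eqP/tinj ->.
apply/tuple_uniqP => i j tij; apply/eqP/negPn/negP => ij.
by have := tn i I j ij; rewrite /= tij eqxx.
Qed.

(** An open subset of [X^n] belongs to the product sigma-algebra, being a
    countable union of boxes of the countable base. *)
Lemma measurable_row_open n (U : set 'rV[X]_n) : open U ->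
  measurable [set t : n.-tuple (borel X) | U (\row_i tnth t i)].
Proof.
have [V [Vopen Vbase]] := countable_base.
pose box (a : n.-tuple nat) : set (n.-tuple (borel X)) :=
  \bigcap_(i in [set: 'I_n]) ((fun t => tnth t i) @^-1` V (tnth a i)).
move=> oU; rewrite [X in measurable X](_ : _ = \bigcup_(a in
   [set a | box a `<=` [set t | U (\row_i tnth t i)]]) box a).
  rewrite bigcup_mkcond; apply: countable_bigcupT_measurable => // a.
  case: ifP => // _; apply: fin_bigcap_measurable => [|i _]; first exact: finite_finset.
  rewrite -[X in measurable X]setTI; apply: measurable_tnth => //.
  by apply: sub_sigma_algebra; exact: Vopen.
apply/seteqP; split => [t /= Ut|t [a /= aU]]; last exact: aU.
have [P Pt PU] : nbhs (\row_i tnth t i) U by exact: open_nbhs_nbhs.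
have /choice[a Pa] (i : 'I_n) : exists a, V a (tnth t i) /\ V a `<=` P 0 i.
  by have := Pt 0 i; rewrite mxE => /Vbase[a ? ?]; exists a.
exists [tuple a i | i < n]; last first.
  by move=> i _; rewrite /= tnth_mktuple; case: (Pa i).
move=> s sa; apply: PU => i j; rewrite mxE ord1.
by have := sa j I; rewrite /= tnth_mktuple; exact: (Pa j).2.
Qed.

Lemma row_tupleK n (t : n.-tuple X) : row_tuple (\row_i tnth t i) = t.
Proof. by apply: eq_from_tnth => i; rewrite tnth_mktuple mxE. Qed.

Lemma mem_conf_of n (t : n.-tuple X) x :
  (x \in (conf_of t : {fset X})) = (x \in tval t).
Proof. by rewrite inE. Qed.

Lemma card_conf_of n (t : n.-tuple X) :
  uniq t -> #|` (conf_of t : {fset X})| = n.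
Proof. by move=> ut; rewrite card_fseq undup_id // size_tuple. Qed.

Lemma measurable_conf_of n : measurable_fun (@uniq_tuples n)
  (fun t : n.-tuple (borel X) => conf_of t : borel (configuration X)).
Proof.
apply: (@measurability _ _ (n.-tuple (borel X)) (borel (configuration X))
  _ _ (@open (configuration X))) => //.
move=> _ [A oA <-].
have /open_subspaceP[V oV VA] := oA n.
rewrite [X in measurable X](_ : _ =
  @uniq_tuples n `&` [set t : n.-tuple (borel X) | V (\row_i tnth t i)]).
  apply: measurableI; first exact: measurable_uniq_tuples.
  exact: measurable_row_open.
apply/seteqP; split => t [ut At]; split=> //.
  suff : (V `&` [set x : 'rV[X]_n | uniq (row_tuple x)]) (\row_i tnth t i).
    by case.
  by rewrite VA; split; rewrite /mkset (row_tupleK t).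
suff : ((fun x : 'rV_n => A (conf_of (row_tuple x))) `&`
    [set x : 'rV[X]_n | uniq (row_tuple x)]) (\row_i tnth t i).
  by case; rewrite (row_tupleK t).
by rewrite -VA; split => //; rewrite /mkset (row_tupleK t).
Qed.

Lemma open_card n : open [set eta : configuration X | #|` (eta : {fset X})| = n].
Proof.
rewrite conf_openE => k; apply/open_subspaceP.
exists [set _ | k = n].
  have [kn|kn] := pselect (k = n).
    by rewrite (_ : [set _ | _] = setT); [exact: openT|apply/seteqP; split].
  by rewrite (_ : [set _ | _] = set0); [exact: open0|apply/seteqP; split].
by apply/seteqP; split => x [H ux]; split => //; move: H; rewrite /= card_conf_of.
Qed.

Lemma open_hit (V : set X) : open V ->
  open [set eta : configuration X | exists2 x, x \in (eta : {fset X}) & V x].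
Proof.
rewrite conf_openE => oV k; apply/open_subspaceP.
exists [set x : 'rV[X]_k | exists i, V (x 0 i)].
  rewrite openE => x [i Vi] /=.
  exists (fun j l => if l == i then V else setT) => [j l|y /(_ 0 i)].
    by case: eqP => [->|_]; [rewrite ord1; exact: open_nbhs_nbhs|exact: filterT].
  by rewrite eqxx => Vy; exists i.
apply/seteqP; split => x [H ux]; split => //; move: H.
  move=> [i Vi]; exists (x 0 i) => //; rewrite mem_conf_of.
  by apply/tnthP; exists i; rewrite tnth_mktuple.
move=> [y]; rewrite mem_conf_of => /tnthP[i ->]; rewrite tnth_mktuple.
by exists i.
Qed.

Lemma separate_points n (t : n.-tuple X) : uniq t ->
  exists A : 'I_n -> set X, (forall i, nbhs (tnth t i) (A i)) /\
    (forall i j, i != j -> A i `&` A j = set0).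
Proof.
move=> /tuple_uniqP tinj.
have /choice[S Sij] (p : 'I_n * 'I_n) : exists S : set X * set X,
    p.1 != p.2 -> [/\ nbhs (tnth t p.1) S.1, nbhs (tnth t p.2) S.2 &
     S.1 `&` S.2 = set0].
  case: (eqVneq p.1 p.2) => [->|ij]; first by exists (setT, setT).
  move: X_hausdorff; rewrite open_hausdorff => /(_ (tnth t p.1) (tnth t p.2)).
  have tij : tnth t p.1 != tnth t p.2 by apply: contra ij => /eqP/tinj ->.
  by move=> /(_ tij)[S [/set_mem ? /set_mem ?] [? ? /eqP ?]]; exists S;
  split => //; exact: open_nbhs_nbhs.
exists (fun i => [set x | forall j, i != j -> (S (i, j)).1 x /\ (S (j, i)).2 x]).
split=> [i|i j ij].
  apply: filter_forall => j; have [->|ij] := eqVneq i j.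
    by apply: nearW => x /eqP.
  have [S1 _ _] := Sij (i, j) ij.
  have [|_ S2 _] := Sij (j, i); first by rewrite /= eq_sym.
  by near=> x => _; split; near: x.
apply/seteqP; split => // x [/(_ j ij)[xA _]].
move=> /(_ i); rewrite eq_sym => /(_ ij)[_ xB].
by have [_ _ <-] := Sij (i, j) ij.
Unshelve. all: by end_near. Qed.

(** The configurations of [n] points that have a point in each of the [n] sets
    [V i]. When these sets are open and pairwise disjoint, this is an open set
    of configurations, on which [(x_1, .., x_n) |-> {x_1, .., x_n}] has a
    measurable section. *)
Definition boxed n (V : 'I_n -> set X) : set (configuration X) :=
  [set eta | #|` (eta : {fset X})| = n /\
    forall i, exists2 x, x \in (eta : {fset X}) & V i x].

(** The tuple of the points of [eta] in the sets [V i]; it is constant outside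
    of [boxed V]. *)
Definition boxed_section n (V : 'I_n -> set X) (eta : configuration X) :
    n.-tuple X :=
  [tuple ((fun eta : configuration X =>
     xget point [set x | x \in (eta : {fset X}) /\ V i x]) \_ (boxed V)) eta
   | i < n].

Lemma boxed_sectionE n (V : 'I_n -> set X) eta i : boxed V eta ->
  tnth (boxed_section V eta) i \in (eta : {fset X}) /\
  V i (tnth (boxed_section V eta) i).
Proof.
move=> Veta; rewrite tnth_mktuple patchE mem_set//.
case: (Veta) => _ /(_ i)[x xeta Vx].
by apply: (xgetPex point (P := [set x | x \in (eta : {fset X}) /\ V i x])); exists x.
Qed.

Lemma boxed_sectionP n (V : 'I_n -> set X) eta :
    (forall i j, i != j -> V i `&` V j = set0) -> boxed V eta ->
  uniq (boxed_section V eta) /\ conf_of (boxed_section V eta) = eta.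
Proof.
move=> Vdisj Veta; have us : uniq (boxed_section V eta).
  apply/tuple_uniqP => i j ij; apply/eqP/negPn/negP => neqij.
  have := Vdisj _ _ neqij; apply/eqP/set0P.
  exists (tnth (boxed_section V eta) i); split.
    by have [] := boxed_sectionE i Veta.
  by rewrite ij; have [] := boxed_sectionE j Veta.
split => //; apply/eqP; rewrite eqEfcard; apply/andP; split.
  apply/fsubsetP => x; rewrite mem_conf_of => /tnthP[i ->].
  by have [] := boxed_sectionE i Veta.
by rewrite card_conf_of //; case: Veta => ->.
Qed.

Lemma measurable_boxed n (V : 'I_n -> set X) : (forall i, open (V i)) ->
  measurable (boxed V : set (borel (configuration X))).
Proof.
move=> oV; rewrite [X in measurable X](_ : _ =
  [set eta : configuration X | #|` (eta : {fset X})| = n] `&`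
  \bigcap_(i in [set: 'I_n])
    [set eta : configuration X | exists2 x, x \in (eta : {fset X}) & V i x]).
  apply: measurableI; first by apply: sub_sigma_algebra; exact: open_card.
  apply: fin_bigcap_measurable => [|i _]; first exact: finite_finset.
  by apply: sub_sigma_algebra; exact: open_hit.
by apply/seteqP; split=> eta /= [? H]; split => // i; [move=> _|]; exact: H.
Qed.

Lemma measurable_boxed_section n (V : 'I_n -> set X) :
    (forall i, open (V i)) -> (forall i j, i != j -> V i `&` V j = set0) ->
  measurable_fun [set: borel (configuration X)]
    (boxed_section V : _ -> n.-tuple (borel X)).
Proof.
move=> oV Vdisj; apply/measurable_fun_tnthP => i.
rewrite (_ : _ \o _ = (fun eta : configuration X =>
     xget point [set x | x \in (eta : {fset X}) /\ V i x] : borel X)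
      \_ (boxed V)); last first.
  by apply/funext => eta; rewrite /= tnth_mktuple.
apply/(measurable_restrictT _ (measurable_boxed oV)).
apply: (@measurability _ _ (borel (configuration X)) (borel X)
  _ _ (@open X)) => //.
move=> _ [A oA <-].
rewrite [X in measurable X](_ : _ = boxed V `&`
  [set eta : configuration X |
    exists2 x, x \in (eta : {fset X}) & (V i `&` A) x]).
  apply: measurableI; first exact: (measurable_boxed oV).
  by apply: sub_sigma_algebra; exact: (open_hit (openI (oV i) oA)).
apply/seteqP; split => eta [Veta Aeta]; split => //.
  have := boxed_sectionE i Veta; rewrite tnth_mktuple patchE mem_set//.
  by move=> [? ?]; eexists; [eassumption|split].
move: Aeta => [x xeta [Vx Ax]]; rewrite /preimage /=.
have := boxed_sectionE i Veta; have [us ceta] := boxed_sectionP Vdisj Veta.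
move: xeta; rewrite -{1}ceta mem_conf_of => /tnthP[j xj].
have := boxed_sectionE j Veta; rewrite -xj => -[_ Vjx].
have ij : i = j.
  apply/eqP/negPn/negP => ij; have : (V i `&` V j) x by split.
  by rewrite Vdisj.
by rewrite -ij tnth_mktuple patchE mem_set// in xj; rewrite -xj.
Qed.

(** The quotient Borel structure is the one induced by tuples: a function of a
    configuration is Borel as soon as it is a Borel function of the
    coordinates of tuples of distinct points. *)
Lemma measurable_fun_configuration d (Z : measurableType d)
    (F : configuration X -> Z) :
  (forall n, measurable_fun (@uniq_tuples n)
     (fun t : n.-tuple (borel X) => F (conf_of t))) ->
  measurable_fun [set: borel (configuration X)] F.
Proof.
move=> mF _ A mA; rewrite setTI.
have [V [Vopen Vbase]] := countable_base.
(* [boxed (W a)], for [a] a list of indices of pairwise disjoint sets of the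
   base, is the countable cover of the space of configurations. *)
pose W (a : seq nat) (i : 'I_(size a)) := V (tnth (in_tuple a) i).
pose J := [set a : seq nat | forall i j, i != j -> W a i `&` W a j = set0].
rewrite [X in measurable X](_ : _ =
    \bigcup_(a in J) (boxed (W a) `&`
      boxed_section (W a) @^-1` (@uniq_tuples (size a) `&`
       [set t | A (F (conf_of t))]))).
  rewrite bigcup_mkcond; apply: countable_bigcupT_measurable => // a.
  case: ifPn => // /set_mem Ja; apply: measurableI.
    by apply: measurable_boxed => i; exact: Vopen.
  rewrite -[X in measurable X]setTI; apply: measurable_boxed_section => //.
    by move=> i; exact: Vopen.
  by apply: mF => //; exact: measurable_uniq_tuples.
apply/seteqP; split => [eta Aeta|eta [a Ja [Weta [_]]]]; last first.
  by rewrite /= (boxed_sectionP Ja Weta).2.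
pose t : #|` (eta : {fset X})|.-tuple X := in_tuple (eta : {fset X}).
have ut : uniq t by exact: fset_uniq.
have [U [tU Udisj]] := separate_points ut.
have /choice[b Ub] i : exists a, V a (tnth t i) /\ V a `<=` U i.
  by have [a] := Vbase _ _ (tU i); exists a.
pose a := mkseq (fun k => if insub k is Some i then b i else 0%N)
   #|` (eta : {fset X})|.
have sa : size a = #|` (eta : {fset X})| by rewrite size_mkseq.
have Wa i : W a i = V (b (cast_ord sa i)).
  rewrite /W (tnth_nth 0%N) /= nth_mkseq; last by rewrite -[X in (_ < X)%N]sa.
  case: insubP => [j _ ji|]; last by rewrite -[X in (_ < X)%N]sa ltn_ord.
  by congr (V (b _)); apply: val_inj.
have Ja : J a.
  move=> i j ij; have ij' : cast_ord sa i != cast_ord sa j.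
    by apply: contra ij => /eqP/cast_ord_inj ->.
  apply/seteqP; split => // x []; rewrite !Wa => Vi Vj.
  by rewrite -(Udisj _ _ ij'); split; apply: (Ub _).2.
have Weta : boxed (W a) eta.
  split => // i; exists (tnth t (cast_ord sa i)); first exact: mem_tnth.
  by rewrite Wa; exact: (Ub _).1.
exists a => //; split => //; have [? ceta] := boxed_sectionP Ja Weta.
by split => //=; rewrite ceta.
Qed.

End borel_configuration.

(** * Integrals over tuples of points *)

Section tensor_powers.
Local Open Scope ereal_scope.
Context {R : realType} {X : ptopologicalType}.
Variable m : {sigma_finite_measure set (borel X) -> \bar R}.

(** The identification of [X * X^n] with [X^{n+1}]. *)
Definition cons_pair n (p : borel X * n.-tuple (borel X)) :
  n.+1.-tuple (borel X) := [the n.+1.-tuple (borel X) of p.1 :: p.2].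

Definition uncons n (t : n.+1.-tuple (borel X)) :
  borel X * n.-tuple (borel X) := (thead t, [tuple of behead t]).

Lemma cons_pairK n : cancel (@cons_pair n) (@uncons n).
Proof. by case=> x t; congr pair; apply: val_inj. Qed.

Lemma measurable_cons_pair n : measurable_fun setT (@cons_pair n).
Proof. exact: measurable_cons. Qed.

Lemma measurable_uncons n : measurable_fun setT (@uncons n).
Proof.
apply: measurable_fun_pair; last exact: measurable_behead.
exact: measurable_tnth.
Qed.

Lemma tensor_power_measure n :
  exists mu : {sigma_finite_measure set (n.-tuple (borel X)) -> \bar R},
    (mu : set (n.-tuple (borel X)) -> \bar R) = @tensor_power R X m n.
Proof.
elim: n => [|n [mu muE]].
  by exists (\d_([tuple] : 0.-tuple (borel X))).
(* The measure structure of [pushforward], which takes the measurability of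
   the map as an argument. *)
pose nu : {measure set _ -> \bar R} :=
  measure_function_pushforward__canonical__measure_function_Measure
    (m \x mu) (@measurable_cons_pair n).
have nu_sf : sigma_finite setT nu.
  have /sigma_finiteP[F [FT ndF Foo]] := sigma_finiteT m.
  have /sigma_finiteP[G [GT ndG Goo]] := sigma_finiteT mu.
  exists (fun k => @uncons n @^-1` (F k `*` G k)).
    rewrite -preimage_bigcup; apply/seteqP; split => // t _.
    have [i _ Fi] : (\bigcup_k F k) (uncons t).1 by rewrite -FT.
    have [j _ Gj] : (\bigcup_k G k) (uncons t).2 by rewrite -GT.
    exists (maxn i j) => //; split.
      by move: Fi; apply/subsetPset/ndF/leq_maxl.
    by move: Gj; apply/subsetPset/ndG/leq_maxr.
  move=> k; have [mF mFoo] := Foo k; have [mG mGoo] := Goo k; split.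
    rewrite -[X in measurable X]setTI; apply: measurable_uncons => //.
    exact: measurableX.
  rewrite (_ : nu _ = (m \x mu) (F k `*` G k)).
    by rewrite product_measure1E// lte_mul_pinfty// ge0_fin_numE.
  congr ((m \x mu) _); apply/seteqP.
  by split => p pk; [rewrite -(cons_pairK p)|rewrite -(cons_pairK p) in pk].
pose nu' : {sigma_finite_measure set _ -> \bar R} :=
  HB.pack (nu : set _ -> \bar R) (Measure.class nu)
    (Measure_isSigmaFinite.Build _ _ _ nu nu_sf).
by exists nu'; rewrite /= -muE.
Qed.

(** [tensor_power m n] as a sigma-finite measure. *)
Definition tensor n : {sigma_finite_measure set (n.-tuple (borel X)) -> \bar R} :=
  sval (cid (tensor_power_measure n)).

Lemma tensorE n :
  (tensor n : set (n.-tuple (borel X)) -> \bar R) = @tensor_power R X m n.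
Proof. by rewrite /tensor; case: cid. Qed.

(** Functions of a finite list of points, nonnegative and measurable in the
    points for each length of the list. *)
Definition seq_fun (F : seq X -> \bar R) : Prop :=
  (forall s, 0 <= F s) /\
  forall n, measurable_fun [set: n.-tuple (borel X)]
    (fun t : n.-tuple (borel X) => F t).

Lemma seq_fun_cons F x : seq_fun F -> seq_fun (F \o cons x).
Proof.
move=> [F0 mF]; split=> [s|n]; first exact: F0.
apply: (measurableT_comp (mF n.+1)
  (g := fun t : n.-tuple (borel X) => [the _.-tuple _ of (x : borel X) :: t])).
exact: measurable_cons.
Qed.

Lemma measurable_tensor_int_cons n F : seq_fun F ->
  measurable_fun [set: borel X] (fun x => \int[tensor n]_t F (x :: t)).
Proof.
move=> [F0 mF]; apply: (measurable_fun_fubini_tonelli_F (m2 := tensor n)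
  (fun p : (borel X * n.-tuple (borel X))%type => F (p.1 :: p.2))) => //.
exact: (measurableT_comp (mF n.+1) (@measurable_cons_pair n)).
Qed.

Lemma tensor_int0 F : seq_fun F -> \int[tensor 0]_t F t = F [::].
Proof.
move=> [F0 mF]; rewrite tensorE /= integral_dirac ?diracT ?mul1e//.
exact: (mF 0%N).
Qed.

Lemma tensor_intS n F : seq_fun F ->
  \int[tensor n.+1]_t F t = \int[m]_x \int[tensor n]_t F (x :: t).
Proof.
move=> [F0 mF].
have -> : \int[tensor n.+1]_t F t =
    \int[pushforward (m \x tensor n) (@cons_pair n)]_t F t.
  by rewrite tensorE /= -tensorE.
rewrite (ge0_integral_pushforward (@measurable_cons_pair n))//; last first.
  exact: (mF n.+1).
rewrite preimage_setT fubini_tonelli1 //; last by move=> p; exact: F0.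
exact: (measurableT_comp (mF n.+1) (@measurable_cons_pair n)).
Qed.

Lemma seq_fun_if (b : seq X -> bool) F : seq_fun F ->
    (forall n, measurable [set t : n.-tuple (borel X) | b t]) ->
  seq_fun (fun s => if b s then F s else 0).
Proof.
move=> [F0 mF] mb; split=> [s|n]; first by case: ifP.
apply: (@measurable_fun_ifT _ _ (n.-tuple (borel X)) (\bar R) (fun t => F t)
  (fun=> 0) (fun t : n.-tuple (borel X) => b t)) => //; last exact: mF.
by apply: (measurable_fun_bool true); rewrite setTI; exact: mb.
Qed.

Hypothesis X_hausdorff : hausdorff_space X.
Hypothesis X_countable : @second_countable X.
Hypothesis m_nonatomic : forall x : X, m [set x] = 0.

Lemma measurable_point (x : X) : measurable ([set x] : set (borel X)).
Proof.
rewrite -[X in measurable X]setCK; apply: measurableC.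
apply: sub_sigma_algebra; apply: closed_openC.
exact/accessible_closed_set1/hausdorff_accessible.
Qed.

Lemma measurable_notin n (x : X) :
  measurable [set t : n.-tuple (borel X) | x \notin tval t].
Proof.
rewrite [X in measurable X](_ : _ = \bigcap_(i in [set: 'I_n])
    ((fun t => tnth t i) @^-1` ~` [set x])).
  apply: fin_bigcap_measurable => [|i _]; first exact: finite_finset.
  rewrite -[X in measurable X]setTI; apply: measurable_tnth => //.
  by apply: measurableC; exact: measurable_point.
apply/seteqP; split => t /= xt.
  by move=> i _ /= ti; move: xt; rewrite -ti mem_tnth.
by apply/negP => /tnthP[i xi]; exact: (xt i).
Qed.

Lemma tensor_int_notin n F x : seq_fun F ->
  \int[tensor n]_t (if x \notin tval t then F t else 0) = \int[tensor n]_t F t.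
Proof.
elim: n F => [|n IHn] F sF.
  by apply: eq_integral => t _; rewrite (tuple0 t).
have sFx : seq_fun (fun s => if x \notin s then F s else 0).
  by apply: seq_fun_if => // k; exact: measurable_notin.
rewrite (tensor_intS n sFx) (tensor_intS n sF).
apply: ge0_ae_eq_integral => //.
- exact: (measurable_tensor_int_cons n sFx).
- exact: (measurable_tensor_int_cons n sF).
- by move=> y _; apply: integral_ge0 => t _; case: ifP => // _; exact: sF.1.
- by move=> y _; apply: integral_ge0 => t _; exact: sF.1.
exists [set x]; split; [exact: measurable_point|exact: m_nonatomic|].
move=> y /= /not_implyP[_ neq]; apply: contrapT => /eqP yx; apply: neq.
rewrite -(IHn (F \o cons y)); last exact: seq_fun_cons.
apply: eq_integral => t _; rewrite in_cons negb_or eq_sym yx.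
by [].
Qed.

(** The tuples with a repeated point are negligible because [m] is
    nonatomic. *)
Lemma tensor_int_uniq n F : seq_fun F ->
  \int[tensor n]_t (if uniq (tval t) then F t else 0) = \int[tensor n]_t F t.
Proof.
elim: n F => [|n IHn] F sF.
  by apply: eq_integral => t _; rewrite (tuple0 t).
have sU G : seq_fun G -> seq_fun (fun s => if uniq s then G s else 0).
  by move=> sG; apply: seq_fun_if => // k; exact: measurable_uniq_tuples.
rewrite (tensor_intS n (sU F sF)) (tensor_intS n sF).
apply: eq_integral => x _; have sFx := seq_fun_cons x sF.
transitivity (\int[tensor n]_t (F \o cons x) t); last by [].
rewrite -(@tensor_int_notin n _ x sFx).
rewrite -(IHn (fun s => if x \notin s then (F \o cons x) s else 0)); last first.
  by apply: seq_fun_if => // k; exact: measurable_notin.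
apply: eq_integral => t _ /=; case: (x \in tval t) => //=.
by case: uniq.
Qed.

End tensor_powers.

(** * Series of nonnegative extended reals *)

Section nonnegative_series.
Local Open Scope ereal_scope.
Context {R : realType}.
Implicit Types x y : (\bar R)^nat.

Lemma nneseriesZl_ereal x (c : \bar R) : 0 <= c -> (forall i, 0 <= x i) ->
  \sum_(i <oo) c * x i = c * \sum_(i <oo) x i.
Proof.
move=> c0 x0; rewrite -(@ge0_integral_count _ x) //.
by rewrite -ge0_integralZl // ge0_integral_count // => i; exact: mule_ge0.
Qed.

Lemma nneseries_finite x n : (forall i, 0 <= x i) ->
  \sum_(k <oo) (if (k <= n)%N then x k else 0) = \sum_(k < n.+1) x k.
Proof.
move=> x0; rewrite (nneseries_split _ n.+1); last by move=> k _; case: ifP.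
rewrite eseries0 ?adde0 => [|k nk _]; last by rewrite leqNgt nk.
by rewrite add0n big_mkord; apply: eq_bigr => k _; rewrite -ltnS ltn_ord.
Qed.

Lemma nneseries_cauchy_product x y :
    (forall i, 0 <= x i) -> (forall i, 0 <= y i) ->
  \sum_(n <oo) \sum_(k < n.+1) x k * y (n - k)%N =
  (\sum_(n <oo) x n) * (\sum_(n <oo) y n).
Proof.
move=> x0 y0; have xy0 i j : 0 <= x i * y j by exact: mule_ge0.
transitivity (\sum_(n <oo) \sum_(k <oo)
    (if (k <= n)%N then x k * y (n - k)%N else 0)).
  apply: eq_eseriesr => n _.
  by rewrite (nneseries_finite (x := fun k => x k * y (n - k)%N)).
rewrite nneseries_interchange; last by move=> i j; case: ifP.
rewrite muleC -nneseriesZl_ereal //; last exact: nneseries_ge0.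
apply: eq_eseriesr => k _; rewrite muleC -nneseriesZl_ereal //.
rewrite -[LHS]eseries_mkcond -[LHS](eseries_cond _ xpredT).
rewrite -nneseries_addn //.
by apply: eq_eseriesr => n _; rewrite addnK.
Qed.

End nonnegative_series.

(** * Convolution of functions of lists *)

(** The star convolution read on lists of points: since it is a sum over the ways
    of splitting a list in two complementary sublists, the first point goes to
    one of the two factors, which gives the Leibniz rule
    [D_x (F * G) = D_x F * G + F * D_x G] with [D_x F s = F (x :: s)]. *)
Fixpoint seq_conv {R : realType} {T : Type} (F G : seq T -> \bar R) (s : seq T)
    : \bar R :=
  (if s is x :: s' then seq_conv (F \o cons x) G s' + seq_conv F (G \o cons x) s'
   else F [::] * G [::])%E.

Section convolution_of_lists.
Local Open Scope ereal_scope.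
Context {R : realType} {X : ptopologicalType}.
Variable m : {sigma_finite_measure set (borel X) -> \bar R}.
Implicit Types F G : seq X -> \bar R.

Lemma seq_conv_ge0 (T : Type) (F G : seq T -> \bar R) s :
  (forall s, 0 <= F s) -> (forall s, 0 <= G s) -> 0 <= seq_conv F G s.
Proof.
elim: s F G => [|x s IHs] F G F0 G0 /=; first exact: mule_ge0.
by apply: adde_ge0; apply: IHs => // t; [exact: F0|exact: G0].
Qed.

Lemma eq_seq_conv (T : eqType) (F F' G G' : seq T -> \bar R) s :
    (forall r, subseq r s -> F r = F' r) ->
    (forall r, subseq r s -> G r = G' r) ->
  seq_conv F G s = seq_conv F' G' s.
Proof.
elim: s F F' G G' => [|x s IHs] F F' G G' FF' GG' /=; first by rewrite FF' ?GG'.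
have sub r : subseq r s -> subseq r (x :: s).
  by move=> rs; exact: subseq_trans rs (subseq_cons s x).
congr (_ + _); apply: IHs => r rs /=.
- by apply: FF'; rewrite /= eqxx.
- by apply: GG'; exact: sub.
- by apply: FF'; exact: sub.
- by apply: GG'; rewrite /= eqxx.
Qed.

(** The recursion of [seq_conv] makes its arguments depend on the points already
    read, hence the parameter space [P]. *)
Lemma measurable_seq_conv n d (P : measurableType d)
    (F G : P -> seq X -> \bar R) :
    (forall k, measurable_fun setT
      (fun q : (P * k.-tuple (borel X))%type => F q.1 q.2)) ->
    (forall k, measurable_fun setT
      (fun q : (P * k.-tuple (borel X))%type => G q.1 q.2)) ->
  measurable_fun setT (fun q : (P * n.-tuple (borel X))%type =>
    seq_conv (F q.1) (G q.1) q.2).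
Proof.
elim: n d P F G => [|n IHn] d P F G mF mG.
  rewrite [X in measurable_fun _ X](_ : _ = (fun q : (P * 0.-tuple (borel X))%type =>
    F q.1 q.2 * G q.1 q.2)); first exact: (emeasurable_funM (mF 0%N) (mG 0%N)).
  by apply/funext => -[p t] /=; rewrite (tuple0 t).
pose split_pt (q : (P * n.+1.-tuple (borel X))%type) :
  ((P * borel X) * n.-tuple (borel X))%type :=
  ((q.1, thead q.2), [tuple of behead q.2]).
have msplit : measurable_fun setT split_pt.
  apply: measurable_fun_pair; first apply: measurable_fun_pair => //.
    exact: (measurableT_comp (@measurable_tnth _ (borel X) n.+1 ord0) measurable_snd).
  exact: (measurableT_comp (@measurable_behead _ (borel X) n) measurable_snd).
have mcons (H : P -> seq X -> \bar R) k :
    (forall k, measurable_fun setT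
      (fun q : (P * k.-tuple (borel X))%type => H q.1 q.2)) ->
    measurable_fun setT (fun q : ((P * borel X) * k.-tuple (borel X))%type =>
      H q.1.1 (q.1.2 :: q.2)).
  move=> mH; pose ins (q : ((P * borel X) * k.-tuple (borel X))%type) :
    (P * k.+1.-tuple (borel X))%type :=
    (q.1.1, [the k.+1.-tuple (borel X) of q.1.2 :: q.2]).
  apply: (measurableT_comp (mH k.+1) (g := ins)).
  apply: measurable_fun_pair; first exact: (measurableT_comp measurable_fst measurable_fst).
  apply: measurable_cons => //.
  exact: (measurableT_comp measurable_snd measurable_fst).
have mkeep (H : P -> seq X -> \bar R) k :
    (forall k, measurable_fun setT
      (fun q : (P * k.-tuple (borel X))%type => H q.1 q.2)) ->
    measurable_fun setT (fun q : ((P * borel X) * k.-tuple (borel X))%type =>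
      H q.1.1 q.2).
  move=> mH; pose proj (q : ((P * borel X) * k.-tuple (borel X))%type) :
    (P * k.-tuple (borel X))%type := (q.1.1, q.2).
  apply: (measurableT_comp (mH k) (g := proj)).
  apply: measurable_fun_pair => //.
  exact: (measurableT_comp measurable_fst measurable_fst).
pose F' (p : (P * borel X)%type) s := F p.1 (p.2 :: s).
pose G' (p : (P * borel X)%type) s := G p.1 (p.2 :: s).
rewrite [X in measurable_fun _ X](_ : _ =
   ((fun q : ((P * borel X) * n.-tuple (borel X))%type =>
     seq_conv (F' q.1) (G q.1.1) q.2) \o split_pt) \+
   ((fun q : ((P * borel X) * n.-tuple (borel X))%type =>
     seq_conv (F q.1.1) (G' q.1) q.2) \o split_pt)).
  have m1 := IHn _ _ F' (fun p s => G p.1 s)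
    (fun k => mcons F k mF) (fun k => mkeep G k mG).
  have m2 := IHn _ _ (fun p s => F p.1 s) G'
    (fun k => mkeep F k mF) (fun k => mcons G k mG).
  exact: (emeasurable_funD (measurableT_comp m1 msplit)
                           (measurableT_comp m2 msplit)).
by apply/funext => -[p t]; rewrite /= [in LHS](tuple_eta t).
Qed.

Lemma measurable_seq_conv_tuple n F G :
    (forall k, measurable_fun [set: k.-tuple (borel X)]
       (fun t : k.-tuple (borel X) => F t)) ->
    (forall k, measurable_fun [set: k.-tuple (borel X)]
       (fun t : k.-tuple (borel X) => G t)) ->
  measurable_fun [set: n.-tuple (borel X)]
    (fun t : n.-tuple (borel X) => seq_conv F G t).
Proof.
move=> mF mG; have mc (H : seq X -> \bar R) : (forall k,
    measurable_fun [set: k.-tuple (borel X)]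
      (fun t : k.-tuple (borel X) => H t)) -> forall k,
    measurable_fun setT (fun q : (borel X * k.-tuple (borel X))%type => H q.2).
  by move=> mH k; exact: (measurableT_comp (mH k) measurable_snd).
have mFG := @measurable_seq_conv n _ (borel X) (fun=> F) (fun=> G)
  (mc _ mF) (mc _ mG).
apply: (measurableT_comp mFG
  (g := fun t : n.-tuple (borel X) => (point : borel X, t))).
by apply: measurable_fun_pair => //; exact: measurable_id.
Qed.

Lemma seq_fun_conv F G : seq_fun F -> seq_fun G -> seq_fun (seq_conv F G).
Proof.
move=> [F0 mF] [G0 mG]; split=> [s|n]; first exact: seq_conv_ge0.
exact: measurable_seq_conv_tuple.
Qed.

(** The [n]-point component of the Lebesgue-Poisson integral, as a functional
    of functions of lists. *)
Definition lp_term n F : \bar R := (n`!%:R^-1)%:E * \int[tensor m n]_t F t.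

Lemma lp_term_ge0 n F : seq_fun F -> 0 <= lp_term n F.
Proof.
move=> [F0 _]; apply: mule_ge0; first by rewrite lee_fin invr_ge0.
exact: integral_ge0.
Qed.

Lemma lp_term0 F : seq_fun F -> lp_term 0 F = F [::].
Proof. by move=> sF; rewrite /lp_term tensor_int0 // fact0 invr1 mul1e. Qed.

Lemma measurable_lp_term_cons n F : seq_fun F ->
  measurable_fun [set: borel X] (fun x => lp_term n (F \o cons x)).
Proof.
move=> sF; apply: measurable_funeM.
exact: (measurable_tensor_int_cons m n sF).
Qed.

Lemma lp_termS n F : seq_fun F ->
  n.+1%:R%:E * lp_term n.+1 F = \int[m]_x lp_term n (F \o cons x).
Proof.
move=> sF; rewrite /lp_term tensor_intS // muleA -EFinM factS natrM invfM.
rewrite mulrA divff ?mul1r ?pnatr_eq0 // ge0_integralZl_EFin //.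
- by move=> x _; apply: integral_ge0 => t _; exact: sF.1.
- exact: (measurable_tensor_int_cons m n sF).
Qed.

Lemma lp_termD n F G : seq_fun F -> seq_fun G ->
  lp_term n (fun s => F s + G s) = lp_term n F + lp_term n G.
Proof.
move=> [F0 mF] [G0 mG]; rewrite /lp_term ge0_integralD //; last 2 first.
- exact: mF.
- exact: mG.
by rewrite ge0_muleDr //; exact: integral_ge0.
Qed.

(** Both sides satisfy the recursion [lp_termS]: multiplied by [n + 1], the
    [k]-th product on the right splits as [k + (n + 1 - k)] copies, which come
    from the two terms of the Leibniz rule. *)
Lemma lp_term_conv n F G : seq_fun F -> seq_fun G ->
  lp_term n (seq_conv F G) = \sum_(k < n.+1) lp_term k F * lp_term (n - k) G.
Proof.
elim: n F G => [|n IHn] F G sF sG.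
  rewrite big_ord_recl big_ord0 adde0 !lp_term0 //.
  exact: seq_fun_conv.
have sC := seq_fun_cons.
have tt0 j k : 0 <= lp_term j F * lp_term k G.
  by apply: mule_ge0; exact: lp_term_ge0.
have n0 j : 0 <= j%:R%:E :> \bar R by rewrite lee_fin.
have nn0 : n.+1%:R != 0%R :> R by rewrite pnatr_eq0.
have nK z : (n.+1%:R^-1)%:E * (n.+1%:R%:E * z) = z :> \bar R.
  by rewrite muleA -EFinM mulVf // mul1e.
suff : n.+1%:R%:E * lp_term n.+1 (seq_conv F G) =
  n.+1%:R%:E * \sum_(k < n.+2) lp_term k F * lp_term (n.+1 - k) G.
  move=> /(congr1 (fun z => (n.+1%:R^-1)%:E * z)).
  by rewrite !nK.
rewrite lp_termS; last exact: seq_fun_conv.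
pose A k x := lp_term k (F \o cons x) * lp_term (n - k) G.
pose B k x := lp_term k F * lp_term (n - k) (G \o cons x).
have A0 k x : 0 <= A k x.
  by apply: mule_ge0; apply: lp_term_ge0 => //; exact: sC.
have B0 k x : 0 <= B k x.
  by apply: mule_ge0; apply: lp_term_ge0 => //; exact: sC.
have mA k : measurable_fun [set: borel X] (A k).
  rewrite /A; under eq_fun do rewrite muleC.
  by apply: measurable_funeM; exact: measurable_lp_term_cons.
have mB k : measurable_fun [set: borel X] (B k).
  by apply: measurable_funeM; exact: measurable_lp_term_cons.
have intA k : \int[m]_x A k x =
    k.+1%:R%:E * (lp_term k.+1 F * lp_term (n - k) G).
  rewrite muleA lp_termS // /A; under eq_integral do rewrite muleC.
  rewrite ge0_integralZl //; first by rewrite muleC.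
  - exact: measurable_lp_term_cons.
  - by move=> x _; apply: lp_term_ge0; exact: sC.
  - exact: lp_term_ge0.
have intB k : \int[m]_x B k x =
    (n - k).+1%:R%:E * (lp_term k F * lp_term (n - k).+1 G).
  rewrite muleCA lp_termS // /B ge0_integralZl //.
  - exact: measurable_lp_term_cons.
  - by move=> x _; apply: lp_term_ge0; exact: sC.
  - exact: lp_term_ge0.
transitivity (\int[m]_x (\sum_(k < n.+1) A k x + \sum_(k < n.+1) B k x)).
  apply: eq_integral => x _; rewrite -!IHn //; try exact: sC.
  by rewrite -lp_termD //; apply: seq_fun_conv => //; exact: sC.
rewrite (ge0_integralD m measurableT); first last.
- by apply: emeasurable_sum => k.
- by move=> x _; apply: sume_ge0.
- by apply: emeasurable_sum => k.
- by move=> x _; apply: sume_ge0.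
rewrite ge0_sume_distrr //.
transitivity (\sum_(k < n.+2)
   (k%:R%:E * (lp_term k F * lp_term (n.+1 - k) G) +
    (n.+1 - k)%:R%:E * (lp_term k F * lp_term (n.+1 - k) G))); last first.
  apply: eq_bigr => k _; rewrite -ge0_muleDl // -EFinD -natrD subnKC //.
  by rewrite -ltnS.
rewrite big_split /=; congr (_ + _).
  rewrite big_ord_recl /= mul0e add0e (ge0_integral_sum m measurableT) //.
  by apply: eq_bigr => k _; rewrite intA /bump /= add1n subSS.
rewrite big_ord_recr /= subnn mul0e adde0 (ge0_integral_sum m measurableT) //.
by apply: eq_bigr => k _; rewrite intB subSn // -ltnS.
Qed.

Lemma lp_series_conv F G : seq_fun F -> seq_fun G ->
  \sum_(n <oo) lp_term n (seq_conv F G) =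
  (\sum_(n <oo) lp_term n F) * (\sum_(n <oo) lp_term n G).
Proof.
move=> sF sG; rewrite -nneseries_cauchy_product; last 2 first.
- by move=> n; exact: lp_term_ge0.
- by move=> n; exact: lp_term_ge0.
by apply: eq_eseriesr => n _; exact: lp_term_conv.
Qed.

End convolution_of_lists.

(** * The Lebesgue-Poisson measure *)

Section lebesgue_poisson_measure.
Local Open Scope ereal_scope.
Context {R : realType} {X : ptopologicalType}.
Variable m : {sigma_finite_measure set (borel X) -> \bar R}.
Hypothesis X_hausdorff : hausdorff_space X.
Hypothesis X_countable : @second_countable X.

(** The configuration of the points of a list, [conf_of] without the length. *)
Definition conf_seq (s : seq X) : configuration X := [fset x in s]%fset.

(** The function of lists that represents a function of configurations; it
    vanishes on the lists with repeated points. *)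
Definition on_seqs (G : configuration X -> \bar R) (s : seq X) : \bar R :=
  if uniq s then G (conf_seq s) else 0.

Lemma measurable_on_seqs (G : configuration X -> \bar R) n :
    measurable_fun [set: borel (configuration X)] G ->
  measurable_fun [set: n.-tuple (borel X)]
    (fun t : n.-tuple (borel X) => on_seqs G t).
Proof.
move=> mG; apply: measurable_fun_if => //.
- apply: (measurable_fun_bool true).
  by rewrite setTI; exact: measurable_uniq_tuples.
- rewrite setTI.
  exact: (measurableT_comp mG
    (measurable_conf_of X_hausdorff X_countable (n := n))).
Qed.

Lemma seq_fun_on_seqs (G : configuration X -> \bar R) : (forall eta, 0 <= G eta) ->
  measurable_fun [set: borel (configuration X)] G -> seq_fun (on_seqs G).
Proof.
move=> G0 mG; split=> [s|n]; first by rewrite /on_seqs; case: ifP.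
exact: measurable_on_seqs.
Qed.

Lemma conf_seq_cons x s : conf_seq (x :: s) = (x |` (conf_seq s : {fset X}))%fset.
Proof. by apply/fsetP => y; rewrite !inE. Qed.

(** A subset of [x |` eta], with [x] not in [eta], is a subset of [eta] with or
    without [x] added. *)
Lemma star_conv_cons (G1 G2 : configuration X -> R) x s : x \notin s ->
  star_conv G1 G2 (conf_seq (x :: s)) =
  (star_conv (fun eta => G1 (x |` (eta : {fset X}))%fset) G2 (conf_seq s) +
   star_conv G1 (fun eta => G2 (x |` (eta : {fset X}))%fset) (conf_seq s))%R.
Proof.
move=> xs; rewrite conf_seq_cons /star_conv.
set eta : {fset X} := conf_seq s.
have xeta : x \notin eta by rewrite inE.
pose addx (xi : {fset X}) := (x |` xi)%fset.
have xNsub (xi : {fset X}) : xi \in fpowerset eta -> x \notin xi.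
  by rewrite fpowersetE => /fsubsetP xi_eta; apply: contra xeta => /xi_eta.
have split_powerset : perm_eq (fpowerset (x |` eta)%fset)
    ([seq addx xi | xi <- fpowerset eta] ++ fpowerset eta).
  apply: uniq_perm; first exact: fset_uniq.
    rewrite cat_uniq map_inj_in_uniq ?fset_uniq /=; last first.
      move=> A B /xNsub xA /xNsub xB AB.
      by rewrite -(fsetU1K xA) -(fsetU1K xB) -/(addx A) AB.
    rewrite andbT; apply/hasPn => A Aeta; apply/mapP => -[B _ AB].
    by have := xNsub _ Aeta; rewrite AB !inE eqxx.
  move=> A; rewrite mem_cat fpowersetE; apply/idP/orP.
    move=> Asub; have [xA|xA] := boolP (x \in A).
      left; apply/mapP; exists (A `\ x)%fset; last by rewrite /addx fsetD1K.
      by rewrite fpowersetE fsubDset.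
    right; rewrite fpowersetE; apply/fsubsetP => y yA.
    have := fsubsetP Asub _ yA; rewrite !inE => /orP[/eqP yx|//].
    by move: xA; rewrite -yx yA.
  move=> [/mapP[B]|]; rewrite fpowersetE => Beta.
    by move=> ->; exact: fsetUS.
  exact: fsubset_trans Beta (fsubsetU1 _ _).
rewrite (perm_big _ split_powerset) big_cat big_map /=; congr (_ + _)%R.
  rewrite !big_seq; apply: eq_bigr => xi xieta; congr (_ * G2 _)%R.
  apply/fsetP => y; rewrite !inE negb_or -andbA.
  by case: (eqVneq y x) => //= ->; rewrite (negbTE xs) andbF.
rewrite !big_seq; apply: eq_bigr => xi xieta; congr (_ * G2 _)%R.
apply/fsetP => y; rewrite !inE.
by case: (eqVneq y x) => //= ->; rewrite (xNsub _ xieta).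
Qed.

Lemma star_conv_seq (G1 G2 : configuration X -> R) s : uniq s ->
  (star_conv G1 G2 (conf_seq s))%:E =
  seq_conv (EFin \o G1 \o conf_seq) (EFin \o G2 \o conf_seq) s.
Proof.
elim: s G1 G2 => [|x s IHs] G1 G2 /=.
  move=> _; have -> : conf_seq [::] = (fset0 : {fset X}).
    by apply/fsetP => y; rewrite !inE.
  by rewrite /star_conv fpowerset0 big_seq_fset1 fsetD0.
move=> /andP[xs us]; rewrite star_conv_cons // EFinD !IHs //.
by congr (_ + _); apply: eq_seq_conv => r _ //=; rewrite conf_seq_cons.
Qed.

Lemma on_seqs_star_conv (G1 G2 : configuration X -> R) s : uniq s ->
  (star_conv G1 G2 (conf_seq s))%:E =
  seq_conv (on_seqs (EFin \o G1)) (on_seqs (EFin \o G2)) s.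
Proof.
move=> us; rewrite star_conv_seq //; apply: eq_seq_conv => r rs;
  by rewrite /on_seqs (subseq_uniq rs us).
Qed.

Lemma measurable_star_conv (G1 G2 : configuration X -> R) :
    measurable_fun [set: borel (configuration X)] G1 ->
    measurable_fun [set: borel (configuration X)] G2 ->
  measurable_fun [set: borel (configuration X)] (star_conv G1 G2).
Proof.
move=> mG1 mG2; apply: measurable_fun_configuration => // n.
apply/measurable_EFinP.
apply: (@eq_measurable_fun _ _ _ _ _ (fun t : n.-tuple (borel X) =>
    seq_conv (on_seqs (EFin \o G1)) (on_seqs (EFin \o G2)) t)).
  by move=> t /set_mem ut; rewrite -on_seqs_star_conv.
apply: measurable_funTS; apply: measurable_seq_conv_tuple => k;
  by apply: measurable_on_seqs; exact/measurable_EFinP.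
Qed.

Let mU n := measurable_uniq_tuples X_hausdorff X_countable (n := n).

(* [conf_of] modified outside of the set of tuples of distinct points, where
   its measurability is not needed. *)
Let conf_of_uniq n (t : n.-tuple (borel X)) : borel (configuration X) :=
  if uniq t then conf_of t else (fset0 : {fset X}).

Let measurable_conf_of_uniq n : measurable_fun setT (@conf_of_uniq n).
Proof.
apply: measurable_fun_if => //.
- by apply: (measurable_fun_bool true); rewrite setTI; exact: mU.
- rewrite setTI.
  exact: (measurable_conf_of X_hausdorff X_countable (n := n)).
Qed.

(* The [n]-point component of the Lebesgue-Poisson measure. *)
Let component n : {measure set (borel (configuration X)) -> \bar R} :=
  mscale (n`!%:R^-1)%:nng%R
    (measure_function_pushforward__canonical__measure_function_Measure
      (mrestr (tensor m n) (@mU n)) (@measurable_conf_of_uniq n)).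

Lemma ge0_integral_mrestr d (T : measurableType d)
    (mu : {measure set T -> \bar R}) (D : set T) (mD : measurable D)
    (f : T -> \bar R) : (forall x, 0 <= f x) -> measurable_fun setT f ->
  \int[mrestr mu mD]_x f x = \int[mu]_(x in D) f x.
Proof.
move=> f0 mf; rewrite (@ge0_negligible_integral _ _ _ _ setT (~` D)) //.
- rewrite setDE setCK setTI; apply: eq_measure_integral => A mA AD.
  by rewrite /= /mrestr setIidl.
- exact: measurableC.
- by rewrite /= /mrestr setICl measure0.
Qed.

(** [lebesgue_poisson m] is the sum of the images of the restricted tensor
    powers, hence a measure, and its integral is the sum of the [lp_term]. *)
Lemma lebesgue_poisson_measure :
  exists mu : {measure set (borel (configuration X)) -> \bar R},
    (mu : set (borel (configuration X)) -> \bar R) = lebesgue_poisson m /\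
    forall G : configuration X -> \bar R, (forall eta, 0 <= G eta) ->
      measurable_fun [set: borel (configuration X)] G ->
      \int[mu]_eta G eta =
      \sum_(n <oo) lp_term m n (on_seqs G).
Proof.
exists (mseries component 0); split.
  apply/funext => A; rewrite /mseries /lebesgue_poisson.
  apply: eq_eseriesr => n _; rewrite /component /= /mscale /=; congr (_ * _).
  rewrite /pushforward /mrestr /conf_measure /pushforward -tensorE.
  congr (tensor m n _); apply/seteqP; split => t [At ut]; split => //; move: At;
    by rewrite /preimage /= /conf_of_uniq ut.
move=> G G0 mG; rewrite ge0_integral_measure_series //.
apply: eq_eseriesr => n _; rewrite ge0_integral_mscale //; congr (_ * _).
rewrite (ge0_integral_pushforward (@measurable_conf_of_uniq n)) //.
rewrite preimage_setT ge0_integral_mrestr //=; last first.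
  exact: (measurableT_comp mG (@measurable_conf_of_uniq n)).
rewrite integral_mkcond; apply: eq_integral => t _.
rewrite /= patchE; case: ifPn => [/set_mem ut|/negP tn].
  by rewrite /on_seqs ut /conf_of_uniq ut.
by rewrite /on_seqs ifF //; apply/negP => ut; apply: tn; exact: mem_set.
Qed.

End lebesgue_poisson_measure.

(** * Algebra of the star convolution *)

Section star_convolution.
Context {R : realType} {X : ptopologicalType}.
Implicit Types (u v G : configuration X -> R) (eta : configuration X).

Lemma star_conv_ge0 G1 G2 eta : (forall xi, 0 <= G1 xi) ->
  (forall xi, 0 <= G2 xi) -> 0 <= star_conv G1 G2 eta.
Proof. by move=> G10 G20; apply: sumr_ge0 => xi _; exact: mulr_ge0. Qed.

Lemma norm_star_conv_le G1 G2 G2' eta : (forall xi, `|G2 xi| <= G2' xi) ->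
  `|star_conv G1 G2 eta| <= star_conv (fun xi => `|G1 xi|) G2' eta.
Proof.
move=> G2G2'; apply: le_trans (ler_norm_sum _ _ _) _; apply: ler_sum => xi _.
by rewrite normrM ler_wpM2l.
Qed.

Lemma star_convBl G G' G2 :
  star_conv (fun eta => G eta - G' eta) G2 =
  fun eta => star_conv G G2 eta - star_conv G' G2 eta.
Proof.
apply/funext => eta; rewrite /star_conv -sumrB; apply: eq_bigr => xi _.
by rewrite mulrBl.
Qed.

Lemma star_convBr G1 G G' :
  star_conv G1 (fun eta => G eta - G' eta) =
  fun eta => star_conv G1 G eta - star_conv G1 G' eta.
Proof.
apply/funext => eta; rewrite /star_conv -sumrB; apply: eq_bigr => xi _.
by rewrite mulrBr.
Qed.

Lemma star_powS v n : star_pow v n.+1 = star_conv v (star_pow v n).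
Proof. by []. Qed.

Lemma norm_star_pow_le v n eta :
  `|star_pow v n eta| <= star_pow (fun xi => `|v xi|) n eta.
Proof.
elim: n eta => [|n IHn] eta; last by rewrite !star_powS; exact: norm_star_conv_le.
by rewrite /star_pow /= /star_one ger0_norm // exprn_ge0.
Qed.

Lemma star_pow_ge0 v n eta : (forall xi, 0 <= v xi) -> 0 <= star_pow v n eta.
Proof.
move=> v0; elim: n eta => [|n IHn] eta; first by rewrite /star_pow /= exprn_ge0.
by rewrite star_powS; exact: star_conv_ge0.
Qed.

Lemma star_pow_eq0 v n eta : v (fset0 : {fset X}) = 0 ->
  (#|` (eta : {fset X})| < n)%N -> star_pow v n eta = 0.
Proof.
move=> v0; elim: n eta => // n IHn eta eta_n.
rewrite star_powS /star_conv big_seq big1 // => xi; rewrite fpowersetE => xieta.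
have [->|xi0] := eqVneq xi fset0; first by rewrite v0 mul0r.
rewrite IHn ?mulr0 // (leq_trans _ (eta_n : (_ <= n)%N)) // cardfsD.
rewrite (fsetIidPr xieta) -subn_gt0 subKn ?fsubset_leq_card //.
by rewrite cardfs_gt0.
Qed.

(** [star_exp v eta] is a finite sum. *)
Lemma star_expE v eta n : v (fset0 : {fset X}) = 0 ->
    (#|` (eta : {fset X})| < n)%N ->
  series (fun n => n`!%:R^-1 * star_pow v n eta) n = star_exp v eta.
Proof.
move=> v0 eta_n; rewrite /star_exp; apply/esym/cvg_lim => //.
apply: (@cvg_near_cst _ _ _ _ _ _ _); exists n => // k /= nk.
rewrite /series /= (big_cat_nat (n := n)) //= [X in _ + X](_ : _ = 0) ?addr0 //.
rewrite big_nat_cond big1 // => i /andP[/andP[ni _] _].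
by rewrite star_pow_eq0 ?mulr0 // (leq_trans eta_n).
Qed.

Lemma lp_exponent0 (f : X -> R) : lp_exponent f (fset0 : {fset X}) = 1.
Proof. by rewrite /lp_exponent big_seq_fset0. Qed.

Lemma lp_exponentD (f : X -> R) (eta xi : {fset X}) : (xi `<=` eta)%fset ->
  lp_exponent f eta = lp_exponent f xi * lp_exponent f (eta `\` xi)%fset.
Proof.
move=> xieta; rewrite /lp_exponent (big_fsetID _ (mem xi)) /=; congr (_ * _).
  apply: eq_fbigl => x; rewrite !inE /= andbC; case: (boolP (x \in xi)) => //=.
  by move/(fsubsetP xieta).
by apply: eq_fbigl => x; rewrite !inE /= andbC.
Qed.

Lemma star_conv_lp_exponent (f : X -> R) G1 G2 :
  star_conv (fun eta => lp_exponent f eta * G1 eta)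
            (fun eta => lp_exponent f eta * G2 eta) =
  fun eta => lp_exponent f eta * star_conv G1 G2 eta.
Proof.
apply/funext => eta; rewrite /star_conv mulr_sumr !big_seq.
apply: eq_bigr => xi; rewrite fpowersetE => xieta.
by rewrite (lp_exponentD f xieta) mulrACA.
Qed.

Lemma star_pow_lp_exponent (f : X -> R) u n :
  star_pow (fun eta => lp_exponent f eta * u eta) n =
  fun eta => lp_exponent f eta * star_pow u n eta.
Proof.
elim: n => [|n IHn]; last by rewrite star_powS IHn star_conv_lp_exponent.
apply/funext => eta; rewrite /star_pow /= /star_one.
have [->|eta0] := eqVneq (eta : {fset X}) fset0.
  by rewrite lp_exponent0 mul1r.
by rewrite expr0n cardfs_eq0 (negbTE eta0) mulr0.
Qed.

Lemma star_exp_lp_exponent (f : X -> R) u eta : u (fset0 : {fset X}) = 0 ->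
  star_exp (fun eta => lp_exponent f eta * u eta) eta =
  lp_exponent f eta * star_exp u eta.
Proof.
move=> u0; rewrite -!(@star_expE _ eta #|` (eta : {fset X})|.+1) ?u0 ?mulr0 //.
rewrite /series /= mulr_sumr; apply: eq_bigr => n _.
by rewrite star_pow_lp_exponent mulrCA.
Qed.

End star_convolution.

(** * Lebesgue-Poisson integrals of convolutions *)

Section lebesgue_poisson_integral.
Local Open Scope ereal_scope.
Context {R : realType} {X : ptopologicalType}.
Variable m : {sigma_finite_measure set (borel X) -> \bar R}.
Hypothesis X_hausdorff : hausdorff_space X.
Hypothesis X_countable : @second_countable X.
Hypothesis m_nonatomic : forall x : X, m [set x] = 0.

Variable mu : {measure set (borel (configuration X)) -> \bar R}.
Hypothesis mu_int : forall G : configuration X -> \bar R,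
  (forall eta, 0 <= G eta) ->
  measurable_fun [set: borel (configuration X)] G ->
  \int[mu]_eta G eta = \sum_(n <oo) lp_term m n (on_seqs G).

Implicit Types (u v G : configuration X -> R) (eta : configuration X).

Local Notation conf_measurable := (measurable_fun [set: borel (configuration X)]).
Local Notation conf_integrable G :=
  (mu.-integrable [set: borel (configuration X)] (EFin \o G)).

Lemma ge0_integral_star_conv G1 G2 :
    (forall eta, 0 <= G1 eta)%R -> (forall eta, 0 <= G2 eta)%R ->
    conf_measurable G1 -> conf_measurable G2 ->
  \int[mu]_eta (star_conv G1 G2 eta)%:E =
  \int[mu]_eta (G1 eta)%:E * \int[mu]_eta (G2 eta)%:E.
Proof.
move=> G10 G20 mG1 mG2.
have sG G : (forall eta, 0 <= G eta)%R -> conf_measurable G ->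
    seq_fun (on_seqs (EFin \o G)).
  move=> G0 mG; apply: seq_fun_on_seqs => //.
  exact/measurable_EFinP.
have intE G : (forall eta, 0 <= G eta)%R -> conf_measurable G ->
    \int[mu]_eta (G eta)%:E = \sum_(n <oo) lp_term m n (on_seqs (EFin \o G)).
  move=> G0 mG; apply: (mu_int (G := EFin \o G)) => //.
  exact/measurable_EFinP.
rewrite (intE _ G10 mG1) (intE _ G20 mG2) intE; last 2 first.
- by move=> eta; exact: star_conv_ge0.
- exact: measurable_star_conv.
rewrite -lp_series_conv //; last 2 first.
- exact: sG.
- exact: sG.
apply: eq_eseriesr => n _; rewrite /lp_term; congr (_ * _).
rewrite -[RHS](tensor_int_uniq X_hausdorff X_countable m_nonatomic); last first.
  by apply: seq_fun_conv; exact: sG.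
apply: eq_integral => t _; rewrite {1}/on_seqs; case: ifPn => // ut.
exact: on_seqs_star_conv.
Qed.

Lemma integrable_star_conv G1 G2 : conf_integrable G1 -> conf_integrable G2 ->
  conf_integrable (star_conv G1 G2).
Proof.
move=> iG1 iG2.
have mG1 : conf_measurable G1 by apply/measurable_EFinP; case/integrableP: iG1.
have mG2 : conf_measurable G2 by apply/measurable_EFinP; case/integrableP: iG2.
have mN G : conf_measurable G -> conf_measurable (fun eta => `|G eta|%R).
  by move=> mG; exact: measurableT_comp.
apply: (@le_integrable _ _ _ mu _ measurableT _
  (EFin \o star_conv (fun eta => `|G1 eta|%R) (fun eta => `|G2 eta|%R))).
- by apply/measurable_EFinP; exact: measurable_star_conv.
- move=> eta _; rewrite lee_fin [leRHS]ger0_norm ?norm_star_conv_le //.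
  exact: star_conv_ge0.
apply/integrableP; split.
  by apply/measurable_EFinP; apply: measurable_star_conv => //; exact: mN.
under eq_integral do rewrite /= ger0_norm ?star_conv_ge0 //.
rewrite ge0_integral_star_conv //; [|exact: mN|exact: mN].
have iN1 : conf_integrable (fun eta => `|G1 eta|%R).
  exact: (integrable_abse iG1).
apply: lte_mul_pinfty; [by apply: integral_ge0 => eta _; rewrite lee_fin| |].
  exact: (integrable_fin_num _ iN1).
by case/integrableP: iG2.
Qed.

(** By bilinearity, from the decomposition of [G] as [|G| - (|G| - G)]. *)
Lemma Rintegral_star_conv G1 G2 : conf_integrable G1 -> conf_integrable G2 ->
  (\int[mu]_eta star_conv G1 G2 eta =
   (\int[mu]_eta G1 eta) * (\int[mu]_eta G2 eta))%R.
Proof.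
pose P G1 G2 := (\int[mu]_eta star_conv G1 G2 eta =
  (\int[mu]_eta G1 eta) * (\int[mu]_eta G2 eta))%R.
have parts G : conf_integrable G -> exists G' G'' : configuration X -> R,
    [/\ G = (fun eta => G' eta - G'' eta)%R, conf_integrable G',
        conf_integrable G'', (forall eta, 0 <= G' eta)%R &
        (forall eta, 0 <= G'' eta)%R].
  move=> iG; have iN : conf_integrable (fun eta => `|G eta|%R).
    exact: (integrable_abse iG).
  exists (fun eta => `|G eta|%R), (fun eta => `|G eta| - G eta)%R; split => //.
  - by apply/funext => eta; rewrite subKr.
  - exact: (integrableB measurableT iN iG).
  - by move=> eta; rewrite subr_ge0 ler_norm.
have P_ge0 H1 H2 : conf_integrable H1 -> conf_integrable H2 ->
    (forall eta, 0 <= H1 eta)%R -> (forall eta, 0 <= H2 eta)%R -> P H1 H2.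
  move=> iH1 iH2 H10 H20; rewrite /P /Rintegral ge0_integral_star_conv //.
  - by rewrite fineM //; exact: integrable_fin_num.
  - by apply/measurable_EFinP; case/integrableP: iH1.
  - by apply/measurable_EFinP; case/integrableP: iH2.
move=> /parts[p1 [q1 [-> ip1 iq1 p10 q10]]] /parts[p2 [q2 [-> ip2 iq2 p20 q20]]].
have P_r H : conf_integrable H -> (forall eta, 0 <= H eta)%R ->
    P H (fun eta => p2 eta - q2 eta)%R.
  move=> iH H0; rewrite /P star_convBr !RintegralB //; try exact: integrable_star_conv.
  by rewrite !P_ge0 // mulrBr.
have ipq2 : conf_integrable (fun eta => p2 eta - q2 eta)%R.
  exact: (integrableB measurableT ip2 iq2).
rewrite star_convBl RintegralB //; try exact: integrable_star_conv.
by rewrite !P_r // [in RHS]RintegralB // mulrBl.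
Qed.

Lemma integral_star_one :
  conf_integrable (@star_one R X) /\ (\int[mu]_eta star_one eta = 1)%R.
Proof.
have m1 : conf_measurable (@star_one R X).
  apply: measurable_fun_configuration => // n.
  apply: (@eq_measurable_fun _ _ _ R _ (fun=> (0 ^+ n)%R)); last exact: measurable_cst.
  by move=> t /set_mem ut; rewrite /star_one card_conf_of.
have one0 eta : (0 <= star_one eta :> R)%R by exact: exprn_ge0.
have int1 : \int[mu]_eta (star_one eta)%:E = 1 :> \bar R.
  rewrite mu_int; [|by move=> eta; rewrite lee_fin|exact/measurable_EFinP].
  have s1 : seq_fun (on_seqs (fun eta => (star_one eta : R)%:E)).
    by apply: seq_fun_on_seqs => //; exact/measurable_EFinP.
  rewrite nneseries_recl; [|by move=> n _; exact: lp_term_ge0|by []].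
  rewrite eseries0 ?adde0.
    rewrite lp_term0 // /on_seqs /= /star_one card_fseq /=.
    by rewrite expr0.
  move=> n n0 _; rewrite /lp_term integral0_eq ?mule0 // => t _.
  rewrite /on_seqs; case: ifP => // ut.
  by rewrite /star_one card_fseq undup_id // size_tuple expr0n gtn_eqF.
split; last by rewrite /Rintegral int1.
apply/integrableP; split; first exact/measurable_EFinP.
under eq_integral do rewrite /= ger0_norm //.
by rewrite int1 ltry.
Qed.

Lemma integral_star_pow v n : conf_integrable v ->
  conf_integrable (star_pow v n) /\
  (\int[mu]_eta star_pow v n eta = (\int[mu]_eta v eta) ^+ n)%R.
Proof.
move=> iv; elim: n => [|n [iIH IH]]; first by rewrite expr0; exact: integral_star_one.
split; first by rewrite star_powS; exact: integrable_star_conv.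
by rewrite star_powS Rintegral_star_conv // IH exprS.
Qed.

(** The Bogoliubov functional of an exponential is the exponential of the
    integral. *)
Lemma integral_star_exp v : v (fset0 : {fset X}) = 0%R -> conf_integrable v ->
  \int[mu]_eta (star_exp v eta)%:E = (expR (\int[mu]_eta v eta)%R)%:E.
Proof.
move=> v0 iv; set a := (\int[mu]_eta v eta)%R.
pose w eta := `|v eta|%R.
have iw : conf_integrable w by exact: (integrable_abse iv).
pose A := (\int[mu]_eta w eta)%R.
pose t (z : configuration X -> R) n eta := (n`!%:R^-1 * star_pow z n eta)%R.
have it z n : conf_integrable z -> conf_integrable (t z n).
  move=> iz; have [ip _] := integral_star_pow n iz.
  exact: (integrableZl measurableT (n`!%:R^-1)%R ip).
have intt z n : conf_integrable z ->
    \int[mu]_eta (t z n eta)%:E = (exp_coeff (\int[mu]_eta z eta)%R n)%:E.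
  move=> iz; rewrite -[LHS]fineK; last exact: (integrable_fin_num _ (it z n iz)).
  have [ip ipE] := integral_star_pow n iz.
  by congr EFin; rewrite -/(Rintegral _ _ _) RintegralZl // ipE /exp_coeff /= mulrC.
have tw0 n eta : (0 <= t w n eta)%R.
  by rewrite mulr_ge0 ?invr_ge0 // star_pow_ge0 // => xi; exact: normr_ge0.
(* [g] is [exp* |v|], as a sum in the extended reals. *)
pose g eta := \sum_(n <oo) (t w n eta)%:E.
have mt z n : conf_integrable z ->
    measurable_fun [set: borel (configuration X)] (fun eta => (t z n eta)%:E).
  by move=> iz; case/integrableP: (it z n iz).
have ig : mu.-integrable [set: borel (configuration X)] g.
  have g0 eta : 0 <= g eta.
    by apply: nneseries_ge0 => n _ _; rewrite lee_fin.
  apply/integrableP; split.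
    by apply: ge0_emeasurable_sum => [n eta _ _|n _]; [rewrite lee_fin|exact: mt].
  under eq_integral do rewrite gee0_abs //.
  rewrite integral_nneseries //; last 2 first.
  - by move=> n; exact: mt.
  - by move=> n eta _; rewrite lee_fin.
  under eq_eseriesr do rewrite intt //.
  have /cvg_lim -> // : (fun n => \sum_(0 <= i < n) (exp_coeff A i)%:E) @ \oo -->
      (expR A)%:E; last exact: ltry.
  apply: cvg_EFin; first by apply: nearW => n; rewrite sumEFin.
  rewrite (_ : fine \o _ = series (exp_coeff A)); first exact: is_cvg_series_exp_coeff.
  by apply/funext => n; rewrite /= sumEFin.
pose f_ n eta := (series (t v ^~ eta) n)%:E.
have f_E n : f_ n = (fun eta => \sum_(k < n) (t v k eta)%:E).
  by apply/funext => eta; rewrite /f_ /series /= big_mkord sumEFin.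
have mf_ n : measurable_fun [set: borel (configuration X)] (f_ n).
  by rewrite f_E; apply: emeasurable_sum => k; exact: mt.
have f_f eta : f_ ^~ eta @ \oo --> (star_exp v eta)%:E.
  apply: cvg_near_cst; exists #|` (eta : {fset X})|.+1 => // n /= eta_n.
  by rewrite /f_ star_expE.
have f_g n eta : `|f_ n eta| <= g eta.
  rewrite f_E; apply: (le_trans (lee_abs_sum _ _ _)).
  apply: (@le_trans _ _ (\sum_(0 <= k < n) (t w k eta)%:E)).
    rewrite big_mkord; apply: lee_sum => k _; rewrite lee_fin normrM ger0_norm //.
    by rewrite ler_wpM2l ?invr_ge0 // norm_star_pow_le.
  by apply: nneseries_lim_ge => k _ _; rewrite lee_fin.
have mf : measurable_fun [set: borel (configuration X)]
    (fun eta => (star_exp v eta)%:E).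
  exact: (emeasurable_fun_cvg _ _ mf_ (fun eta _ => f_f eta)).
have ae_f : \forall eta \ae mu, setT eta ->
    f_ ^~ eta @ \oo --> (star_exp v eta)%:E.
  by apply: aeW => eta _; exact: f_f.
have ae_g : \forall eta \ae mu, forall n, setT eta -> `|f_ n eta| <= g eta.
  by apply: aeW => eta n _; exact: f_g.
have [_ _ cvg_int] := dominated_convergence measurableT mf_ mf ae_f ig ae_g.
apply: (cvg_unique _ cvg_int) => //.
rewrite (_ : [sequence _]_n = EFin \o series (exp_coeff a)); last first.
  apply/funext => n /=; rewrite f_E integral_sum //; last first.
    by move=> k; exact: it.
  by rewrite /series /= big_mkord -sumEFin; apply: eq_bigr => k _; rewrite intt.
by apply: cvg_EFin => //; [exact: nearW|exact: is_cvg_series_exp_coeff].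
Qed.

End lebesgue_poisson_integral.

(** * A series with factorials *)

Section factorial_series.
Context {R : realType}.

Lemma exp_coeff_le_expR (x : R) n : 0 <= x -> x ^+ n / n`!%:R <= expR x.
Proof.
move=> x0; have c0 k : 0 <= exp_coeff x k by exact: exp_coeff_ge0.
apply: (@le_trans _ _ (series (exp_coeff x) n.+1)).
  rewrite /series /= big_nat_recr //= ler_wpDl //; exact: sumr_ge0.
apply: nondecreasing_cvgn_le; last exact: is_cvg_series_exp_coeff.
by move=> p q pq; apply: nondecreasing_series.
Qed.

(** [x ^ n / n! ^ p] is the [p]-th power of a term of an exponential series. *)
Lemma powR_factorial_bound (x p : R) n : 0 <= x -> 0 < p ->
  x ^+ n * (n`!%:R^-1 `^ p) <= expR (x `^ p^-1) `^ p.
Proof.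
move=> x0 p0; set y := x `^ p^-1.
have y0 : 0 <= y by exact: powR_ge0.
have -> : x ^+ n * (n`!%:R^-1 `^ p) = (y ^+ n / n`!%:R) `^ p.
  rewrite powRM ?exprn_ge0 ?invr_ge0 //; congr (_ * _).
  have yp : y `^ p = x by rewrite /y -powRrM mulVf ?gt_eqF // powRr1.
  by rewrite -[y ^+ n]powR_mulrn // -powRrM mulrC powRrM yp powR_mulrn.
apply: ge0_ler_powR; [exact: ltW| | |exact: exp_coeff_le_expR].
  by rewrite nnegrE mulr_ge0 ?exprn_ge0 ?invr_ge0.
by rewrite nnegrE expR_ge0.
Qed.

(** Since [delta < 1], the growth [C ^ n * n! ^ delta] is beaten by the weight
    [1 / n!] of the [n]-point component. *)
Lemma factorial_series_lty (c x delta : R) : 0 <= c -> 0 <= x -> delta < 1 ->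
  (\sum_(n <oo) (n`!%:R^-1 * (c * x ^+ n * n`!%:R `^ delta))%:E < +oo)%E.
Proof.
move=> c0 x0 delta1; have p0 : 0 < 1 - delta by rewrite subr_gt0.
set p := 1 - delta in p0.
pose K := c * expR ((2 * x) `^ p^-1) `^ p.
apply: (@le_lt_trans _ _ (\sum_(n <oo) (2 * K / (2 ^ (n + 1))%:R)%:E)%E); last first.
  have /cvg_lim -> // := @cvg_geometric_eseries_half R (2 * K) 0.
  exact: ltry.
apply: lee_nneseries => [n _ _|n _].
  by rewrite lee_fin !mulr_ge0 ?invr_ge0 ?exprn_ge0 ?powR_ge0.
have -> : 2 * K / (2 ^ (n + 1))%:R = K / 2 ^+ n.
  by rewrite natrX addn1 exprS invfM mulrACA divff ?mul1r ?pnatr_eq0.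
rewrite lee_fin ler_pdivlMr ?exprn_gt0 //.
have f0 : 0 < n`!%:R :> R by rewrite ltr0n fact_gt0.
(* The factor [2] in [K] leaves a geometric series of ratio [1 / 2]. *)
have -> : n`!%:R^-1 * (c * x ^+ n * n`!%:R `^ delta) * 2 ^+ n =
    c * ((2 * x) ^+ n * (n`!%:R^-1 `^ p)).
  have -> : n`!%:R^-1 `^ p = n`!%:R^-1 * n`!%:R `^ delta.
    rewrite -(powR_inv1 (ltW f0)) -powRrM mulN1r /p opprB addrC.
    by rewrite powRD //; apply/implyP => _; rewrite gt_eqF.
  by rewrite exprMn; ring.
by rewrite ler_wpM2l // powR_factorial_bound // mulr_ge0.
Qed.

End factorial_series.

(** * Integrability of Lebesgue-Poisson exponents *)

Section lebesgue_poisson_exponent.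
Local Open Scope ereal_scope.
Context {R : realType} {X : ptopologicalType}.
Variable m : {sigma_finite_measure set (borel X) -> \bar R}.
Hypothesis X_hausdorff : hausdorff_space X.
Hypothesis X_countable : @second_countable X.

Variable mu : {measure set (borel (configuration X)) -> \bar R}.
Hypothesis mu_int : forall G : configuration X -> \bar R,
  (forall eta, 0 <= G eta) ->
  measurable_fun [set: borel (configuration X)] G ->
  \int[mu]_eta G eta = \sum_(n <oo) lp_term m n (on_seqs G).

Implicit Types (f : X -> R) (u : configuration X -> R).

Lemma lp_exponent_seq f (s : seq X) : uniq s ->
  lp_exponent f (conf_seq s) = (\prod_(x <- s) f x)%R.
Proof.
move=> us; apply: perm_big; by apply: uniq_perm => // x; rewrite inE.
Qed.

Lemma measurable_seq_prod f n : measurable_fun [set: borel X] f ->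
  measurable_fun [set: n.-tuple (borel X)]
    (fun t : n.-tuple (borel X) => \prod_(x <- t) f x)%R.
Proof.
move=> mf; rewrite [X in measurable_fun _ X](_ : _ =
    (fun t : n.-tuple (borel X) => \prod_(i < n) f (tnth t i))%R).
  apply: measurable_prod => i _.
  exact: (measurableT_comp mf (@measurable_tnth _ (borel X) n i)).
by apply/funext => t; rewrite big_tuple.
Qed.

Lemma measurable_lp_exponent f : measurable_fun [set: borel X] f ->
  measurable_fun [set: borel (configuration X)] (lp_exponent f).
Proof.
move=> mf; apply: measurable_fun_configuration => // n.
apply: (@eq_measurable_fun _ _ (n.-tuple (borel X)) R _
    (fun t : n.-tuple (borel X) => \prod_(x <- t) f x)%R).
  by move=> t /set_mem ut; rewrite -lp_exponent_seq.
exact: measurable_funTS (measurable_seq_prod _).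
Qed.

Lemma norm_lp_exponent f (eta : configuration X) :
  (`|lp_exponent f eta| = lp_exponent (fun x => `|f x|) eta)%R.
Proof. by rewrite /lp_exponent normr_prod. Qed.

Lemma tensor_int_prod f n : (forall x, 0 <= f x)%R ->
    m.-integrable [set: borel X] (EFin \o f) ->
  \int[tensor m n]_t (\prod_(x <- t) f x)%:E = ((\int[m]_x f x)%R ^+ n)%:E.
Proof.
move=> f0 /[dup] fint /integrableP[/measurable_EFinP mf _].
have sprod : seq_fun (fun s : seq X => (\prod_(x <- s) f x)%:E).
  split=> [s|k]; first by rewrite lee_fin prodr_ge0.
  by apply/measurable_EFinP; exact: measurable_seq_prod.
elim: n => [|n IHn]; first by rewrite (tensor_int0 m sprod) big_nil expr0.
rewrite (tensor_intS m n sprod).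
under eq_integral => x _.
  under eq_integral do rewrite big_cons EFinM.
  rewrite ge0_integralZl_EFin //; last 2 first.
  - by move=> t _; exact: sprod.1.
  - exact: sprod.2.
  rewrite IHn muleC; over.
rewrite ge0_integralZl_EFin //; last 3 first.
- by move=> x _; rewrite lee_fin.
- exact/measurable_EFinP.
- by rewrite exprn_ge0 // Rintegral_ge0.
by rewrite -[X in _ * X]fineK ?(integrable_fin_num _ fint) // -EFinM exprSr.
Qed.

Lemma integrable_lp_exponent f u (c C delta : R) :
    (0 < C)%R -> (delta < 1)%R ->
    m.-integrable [set: borel X] (EFin \o f) ->
    measurable_fun [set: borel (configuration X)] u ->
    {ae mu, forall eta, (`|u eta| <=
      c * C ^+ #|` (eta : {fset X})| * ((#|` (eta : {fset X})|)`!%:R `^ delta))%R} ->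
  mu.-integrable [set: borel (configuration X)]
    (EFin \o (fun eta => lp_exponent f eta * u eta)%R).
Proof.
move=> C0 delta1 fint mu_u u_le.
have mf : measurable_fun [set: borel X] f.
  by apply/measurable_EFinP; case/integrableP: fint.
have nfint : m.-integrable [set: borel X] (EFin \o (fun x => `|f x|%R)).
  exact: (integrable_abse fint).
(* The constant [c] may be negative. *)
pose c' := `|c|%R.
pose w (eta : configuration X) : R :=
  (c' * C ^+ #|` (eta : {fset X})| * ((#|` (eta : {fset X})|)`!%:R `^ delta))%R.
have c'0 : (0 <= c')%R by exact: normr_ge0.
have Cge0 := ltW C0.
have w0 eta : (0 <= w eta)%R by rewrite !mulr_ge0 ?exprn_ge0 ?powR_ge0.
have mw : measurable_fun [set: borel (configuration X)] w.
  apply: measurable_fun_configuration => // n.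
  apply: (@eq_measurable_fun _ _ _ R _
      (fun=> c' * C ^+ n * (n`!%:R `^ delta))%R); last exact: (measurable_cst (_ : R)).
  by move=> t /set_mem ut; rewrite /w card_conf_of.
pose e := lp_exponent (fun x => `|f x|%R) : configuration X -> R.
have e0 eta : (0 <= e eta)%R by exact: prodr_ge0.
have me : measurable_fun [set: borel (configuration X)] e.
  by apply: measurable_lp_exponent; exact: measurableT_comp.
have mv : measurable_fun [set: borel (configuration X)]
    (fun eta => lp_exponent f eta * u eta)%R.
  by apply: measurable_funM => //; exact: measurable_lp_exponent.
apply/integrableP; split; first exact/measurable_EFinP.
apply: (@le_lt_trans _ _ (\int[mu]_eta (e eta * w eta)%:E)).
  apply: ae_ge0_le_integral => //.
  - by apply: measurableT_comp => //; exact/measurable_EFinP.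
  - by move=> eta _; rewrite lee_fin mulr_ge0.
  - by apply/measurable_EFinP; exact: measurable_funM.
  case: u_le => N [mN N0 leN]; exists N; split => //.
  apply: subset_trans leN => eta; apply: contra_not => u_le _.
  rewrite /= lee_fin normrM norm_lp_exponent ler_wpM2l //; apply: le_trans u_le _.
  by rewrite ler_wpM2r ?powR_ge0 // ler_wpM2r ?exprn_ge0 // ler_norm.
rewrite mu_int; last 2 first.
- by move=> eta; rewrite lee_fin mulr_ge0.
- by apply/measurable_EFinP; exact: measurable_funM.
set b := (\int[m]_x `|f x|)%R.
have b0 : (0 <= b)%R by apply: Rintegral_ge0.
apply: le_lt_trans (@factorial_series_lty R c' (C * b) delta _ _ delta1) => //;
  last exact: mulr_ge0.
have sG : seq_fun (on_seqs (fun eta => (e eta * w eta)%:E)).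
  apply: seq_fun_on_seqs => //.
  - by move=> eta; rewrite lee_fin mulr_ge0.
  - by apply/measurable_EFinP; exact: measurable_funM.
apply: lee_nneseries => [n _ _|n _]; first exact: lp_term_ge0.
rewrite /lp_term EFinM lee_wpmul2l ?lee_fin ?invr_ge0 //.
set K := (c' * C ^+ n * (n`!%:R `^ delta))%R.
have K0 : (0 <= K)%R by rewrite !mulr_ge0 ?exprn_ge0 ?powR_ge0.
have sprod : seq_fun (fun s : seq X => (\prod_(x <- s) `|f x|)%:E).
  split=> [s|k]; first by rewrite lee_fin prodr_ge0.
  by apply/measurable_EFinP; apply: measurable_seq_prod; exact: measurableT_comp.
apply: (@le_trans _ _ (\int[tensor m n]_t (K%:E * (\prod_(x <- t) `|f x|)%:E))).
  apply: ge0_le_integral => //.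
  - by move=> t _; exact: sG.1.
  - exact: sG.2.
  - by apply: measurable_funeM; exact: sprod.2.
  move=> t _; rewrite /on_seqs; case: ifPn => ut; last first.
    by rewrite lee_fin mulr_ge0 // prodr_ge0.
  rewrite lee_fin /e lp_exponent_seq // /w (card_conf_of ut) mulrC.
  by rewrite lexx.
rewrite ge0_integralZl_EFin //; last 2 first.
- by move=> t _; exact: sprod.1.
- exact: sprod.2.
rewrite tensor_int_prod // -EFinM lee_fin /K exprMn.
by rewrite le_eqVlt; apply/orP; left; apply/eqP; ring.
Qed.

End lebesgue_poisson_exponent.

(** * Positivity of the functional *)

(** A measure with the sigma-finiteness of the whole space is the measure
    underlying a [sigma_finite_measure]. *)
Lemma sigma_finite_measureP d (T : measurableType d) (R : realType)
    (m : {measure set T -> \bar R}) : sigma_finite setT m ->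
  exists m' : {sigma_finite_measure set T -> \bar R},
    m = m' :> {measure set T -> \bar R}.
Proof.
case: m => m0 mC m_sf; pose m1 : {measure set T -> \bar R} := Measure.Pack mC.
pose m' : {sigma_finite_measure set T -> \bar R} :=
  HB.pack m0 mC (Measure_isSigmaFinite.Build _ _ _ m1 m_sf).
by exists m'.
Qed.

Lemma nonatomic_radon_sigma_finite (R : realType) (X : ptopologicalType)
    (m : {measure set (borel X) -> \bar R}) :
  nonatomic_radon m -> has_exhaustion X -> sigma_finite [set: borel X] m.
Proof.
move=> [mfin _] [L [Lcompact _ LT]]; exists L => // n; split.
  by case: (Lcompact n).
exact: mfin.
Qed.

Theorem proposition5p5 (R : realType) (d : nat) (X : ptopologicalType)
  (M : oriented_riemannian_manifold R d X)
  (X_connected : connected [set: X])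
  (X_noncompact : ~ compact [set: X])
  (m : {measure set (borel X) -> \bar R})
  (m_radon : nonatomic_radon m)
  (X_exhaustion : has_exhaustion X)
  (u : configuration X -> R)
  (u_measurable : measurable_fun [set: borel (configuration X)] u)
  (u_empty : u (fset0 : {fset X}) = 0)
  (C C' delta delta' : R)
  (C_gt0 : 0 < C) (C'_gt0 : 0 < C')
  (delta_itv : 0 <= delta < 1) (delta'_itv : 0 <= delta' < 1)
  (u_K : K_space m C delta u)
  (exp_u_K : K_space m C' delta' (star_exp (fun eta => `|u eta|)))
  (f : X -> R)
  (f_L1 : m.-integrable [set: borel X] (EFin \o f)) :
  0 < bogoliubov m (star_exp u) f.
Proof.
have m_sf := nonatomic_radon_sigma_finite m_radon X_exhaustion.
have [m' mm'] := sigma_finite_measureP m_sf; subst m.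
have [mu [muE mu_int]] := lebesgue_poisson_measure m'
  (manifold_hausdorff M) (manifold_second_countable M).
have lpE : lebesgue_poisson m' = mu by rewrite muE.
have [_ [c u_le]] := u_K.
have [_ delta1] := andP delta_itv.
pose v eta := lp_exponent f eta * u eta.
have v0 : v (fset0 : {fset X}) = 0 by rewrite /v u_empty mulr0.
have iv : mu.-integrable [set: borel (configuration X)] (EFin \o v).
  apply: (integrable_lp_exponent (manifold_hausdorff M)
    (manifold_second_countable M) mu_int C_gt0 delta1 f_L1 u_measurable).
  by rewrite -lpE; exact: u_le.
rewrite /bogoliubov lpE.
under eq_integral do rewrite -star_exp_lp_exponent //.
rewrite (integral_star_exp (manifold_hausdorff M) (manifold_second_countable M)
  m_radon.2 mu_int v0 iv).
exact: expR_gt0.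
Qed.
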